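(* Let $(\mathcal{X}_1,\mathcal{X}_2,p(y_2|x_1)p(y_3|x_1,x_2,y_2),\mathcal{Y}_2,\mathcal{Y}_3)$ be a discrete memoryless noncausal relay channel that is degraded, i.e., $p(y_3|x_1,x_2,y_2)=p(y_3|x_2,y_2)$ for all $(x_1,x_2,y_2,y_3)$. Then its capacity is \[ C_{\infty} = \max \min \{I(X_1;Y_2),\; I(X_1,U;Y_3)-I(Y_2;U|X_1)\}, \] where the maximum is over all pmfs $p(x_1)p(u|x_1,y_2)$ (with $U$ taking values in a finite set) and all functions $x_2(u,x_1,y_2)$, and the mutual informations are evaluated under the joint distribution $p(x_1)p(y_2|x_1)p(u|x_1,y_2)\mathbf{1}\{x_2=x_2(u,x_1,y_2)\}p(y_3|x_2,y_2)$.
   Context: A discrete memoryless (DM) noncausal relay channel consists of finite alphabets $\mathcal{X}_1,\mathcal{X}_2,\mathcal{Y}_2,\mathcal{Y}_3$ and conditional pmfs $p(y_2|x_1)$ and $p(y_3|x_1,x_2,y_2)$; the sender inputs $X_1$, the relay observes $Y_2$ and inputs $X_2$, the receiver observes $Y_3$. It is memoryless: $p(y_{2i}|x_1^i,y_2^{i-1},m)=p(y_{2i}|x_{1i})$ and $p(y_{3i}|x_1^i,x_2^i,y_2^i,y_3^{i-1},m)=p(y_{3i}|x_{1i},x_{2i},y_{2i})$. A $(2^{nR},n)$ code consists of a message set $[1:2^{nR}]$, an encoder assigning a codeword $x_1^n(m)$ to each message $m$, a relay encoder assigning a symbol $x_{2i}(y_2^n)$ for each $i\in[1:n]$ as a function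 of the entire received sequence $y_2^n$ (noncausal, i.e., unlimited lookahead), and a decoder assigning an estimate $\hat m(y_3^n)$ or an error. The message $M$ is uniform over $[1:2^{nR}]$, the error probability is $P_e^{(n)}=\mathbb{P}\{\hat M\neq M\}$, a rate $R$ is achievable if there is a sequence of $(2^{nR},n)$ codes with $P_e^{(n)}\to 0$, and the capacity $C_\infty$ is the supremum of achievable rates. *)

(* Defs.v *)
From HB Require Import structures.
From mathcomp Require Import all_boot all_order all_algebra.
From mathcomp Require Import all_classical all_reals all_analysis.
Set Implicit Arguments. Unset Strict Implicit. Unset Printing Implicit Defensive.
Import Order.TTheory GRing.Theory Num.Theory numFieldNormedType.Exports.
Local Open Scope ring_scope.
Local Open Scope classical_set_scope.

(* logarithm base 2 (rates are in bits: message sets of size 2^{nR}) *)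
Definition log2 {R : realType} (x : R) : R := ln x / ln 2.

Definition is_pmf {R : realType} {T : finType} (p : T -> R) : Prop :=
  (forall t, 0 <= p t) /\ \sum_(t : T) p t = 1.

Definition prob {R : realType} {T : finType} (P : T -> R) (E : pred T) : R :=
  \sum_(t : T | E t) P t.

(* mutual information I(F;G) (in bits) of random variables F = f(T), G = g(T),
   T ~ P, i.e. E[ log p(F,G) / (p(F) p(G)) ] (terms with P t = 0 vanish). *)
Definition minf {R : realType} {T : finType} {A B : eqType}
  (P : T -> R) (f : T -> A) (g : T -> B) : R :=
  \sum_(t : T) P t *
    log2 (prob P [pred s | (f s == f t) && (g s == g t)] /
          (prob P [pred s | f s == f t] * prob P [pred s | g s == g t])).

Definition cminf {R : realType} {T : finType} {A B C : eqType}
  (P : T -> R) (f : T -> A) (g : T -> B) (h : T -> C) : R :=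
  \sum_(t : T) P t *
    log2 (prob P [pred s | [&& f s == f t, g s == g t & h s == h t]] *
          prob P [pred s | h s == h t] /
          (prob P [pred s | (f s == f t) && (h s == h t)] *
           prob P [pred s | (g s == g t) && (h s == h t)])).

(* A (M, n) code for the noncausal relay channel: message set 'I_M,
   encoder m |-> x1^n(m), relay map y2^n |-> x2^n (x_{2i} depends on all of
   y2^n), decoder y3^n |-> Some m (estimate) or None (error). *)
Record relay_code (X1 X2 Y2 Y3 : finType) (n M : nat) := RelayCode {
  enc : 'I_M -> {ffun 'I_n -> X1};
  relay : {ffun 'I_n -> Y2} -> {ffun 'I_n -> X2};
  dec : {ffun 'I_n -> Y3} -> option 'I_M }.

(* average probability of error, M uniform; channel p(y2|x1) = W2 x1 y2,
   p(y3|x1,x2,y2) = W3 x1 x2 y2 y3, used memorylessly. *)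
Definition err_prob {R : realType} {X1 X2 Y2 Y3 : finType}
  (W2 : X1 -> Y2 -> R) (W3 : X1 -> X2 -> Y2 -> Y3 -> R) (n M : nat)
  (c : relay_code X1 X2 Y2 Y3 n M) : R :=
  (M%:R)^-1 * \sum_(m < M) \sum_(y2 : {ffun 'I_n -> Y2})
     \sum_(y3 : {ffun 'I_n -> Y3} | dec c y3 != Some m)
       (\prod_(i < n) W2 (enc c m i) (y2 i)) *
       (\prod_(i < n) W3 (enc c m i) (relay c y2 i) (y2 i) (y3 i)).

(* [1 : 2^{nR}] = {1, ..., 2^{ceil(nR)}} (El Gamal--Kim convention) *)
Definition num_msgs {R : realType} (n : nat) (r : R) : nat :=
  (2 ^ `|Num.ceil (n%:R * r)|)%N.

Definition achievable {R : realType} {X1 X2 Y2 Y3 : finType}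
  (W2 : X1 -> Y2 -> R) (W3 : X1 -> X2 -> Y2 -> Y3 -> R) (r : R) : Prop :=
  0 <= r /\
  exists c : forall n : nat, relay_code X1 X2 Y2 Y3 n (num_msgs n r),
    (fun n => err_prob W2 W3 (c n)) @ \oo --> (0 : R).

Definition capacity {R : realType} {X1 X2 Y2 Y3 : finType}
  (W2 : X1 -> Y2 -> R) (W3 : X1 -> X2 -> Y2 -> Y3 -> R) : R :=
  sup [set r | achievable W2 W3 r].

Definition relay_joint {R : realType} {X1 X2 Y2 Y3 : finType} {k : nat}
  (W2 : X1 -> Y2 -> R) (W3 : X1 -> X2 -> Y2 -> Y3 -> R)
  (px : X1 -> R) (pu : X1 -> Y2 -> 'I_k -> R) (f : 'I_k -> X1 -> Y2 -> X2)
  (t : X1 * Y2 * 'I_k * Y3) : R :=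
  let: (x1, y2, u, y3) := t in
  px x1 * W2 x1 y2 * pu x1 y2 u * W3 x1 (f u x1 y2) y2 y3.

Definition relay_value {R : realType} {X1 X2 Y2 Y3 : finType} {k : nat}
  (W2 : X1 -> Y2 -> R) (W3 : X1 -> X2 -> Y2 -> Y3 -> R)
  (px : X1 -> R) (pu : X1 -> Y2 -> 'I_k -> R) (f : 'I_k -> X1 -> Y2 -> X2) : R :=
  let P := relay_joint W2 W3 px pu f in
  let vx1 := fun t : X1 * Y2 * 'I_k * Y3 => t.1.1.1 in
  let vy2 := fun t : X1 * Y2 * 'I_k * Y3 => t.1.1.2 in
  let vu  := fun t : X1 * Y2 * 'I_k * Y3 => t.1.2 in
  let vy3 := fun t : X1 * Y2 * 'I_k * Y3 => t.2 in
  Num.min (minf P vx1 vy2)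
          (minf P (fun t => (vx1 t, vu t)) vy3 - cminf P vy2 vu vx1).

(* Main.v *)
Require Import Defs.
From HB Require Import structures.
From mathcomp Require Import all_boot all_order all_algebra.
From mathcomp Require Import all_classical all_reals all_analysis.
From mathcomp Require Import ring lra.
Set Implicit Arguments. Unset Strict Implicit. Unset Printing Implicit Defensive.
Import Order.TTheory GRing.Theory Num.Theory numFieldNormedType.Exports.
Local Open Scope ring_scope.

(* Achievability: with an auxiliary [U] and a codebook [x1(m), u(m, l)], the relay, which sees
   all of [y2], decodes [m], which succeeds below I(X1;Y2), then looks for an index [l] for
   which [u(m, l)] fits [(x1(m), y2)], which exists when the rate of [l] exceeds I(Y2;U|X1),
   and sends [x2(u, x1, y2)].  The receiver decodes [(m, l)] up to total rate I(X1,U;Y3).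
   The random coding analysis is one-shot, by thresholds on information densities; the block
   version follows from Chebyshev's inequality.

   Converse: since [M - Y2^n - Y3^n] is a Markov chain for a degraded channel, Fano's
   inequality applies to both outputs.  The first gives I(X1;Y2); in the second,
   H(Y2^n|M) - H(Y3^n|M) telescopes along the hybrid sequences (y3_1 .. y3_i, y2_(i+1) .. y2_n),
   which single-letterizes it with [U_i = (M, Y3^(i-1), Y2_(i+1)^n)].  The relay input is not a
   function of [(U_i, Y2_i)], so [U_i] is complemented by an independent random strategy
   [Y2 -> X2]; as H(Y2|Y3) - H(Y3|Y2) is concave in the law of [Y2] for a fixed strategy, all
   values of [(i, U_i)] with the same [x1] and the same strategy can be merged.  Hence
   the strategies [Y2 -> X2] themselves suffice as values of [U], and the maximum exists by
   compactness. *)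

(** * Sums over product spaces and entropy terms *)

(** The receiver never sees y2, yet a [u] chosen to fit (x1, y2) must also fit y3. In place of a
    Markov lemma for typical sequences, an index counts as suitable only if the conditional
    probability, given (x1, y2, u), that the receiver's test fails is small. The relay can evaluate
    this probability, and Markov's inequality shows that it is rarely large. In the converse, a
    strategy drawn independently of Y2 given U_i leaves the conditional entropy of Y2 unchanged and
    can only lower that of Y3, so the difference of the two does not decrease when the randomness of
    X2 moves into the auxiliary. Merging needs one kernel from y2 to y3, which a common x1 and a
    common strategy provide. It yields an auxiliary alphabet that does not depend on the block
    length, so that one compact set of laws serves all codes. Rates are computed in nats and
    rewritten through -x ln x of polynomials in the laws; unlike logarithms of ratios, these are
    continuous also at zero probabilities. *)

Section ProductWeights.
Variables (R : realType) (I T : finType).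
Implicit Types (w : I -> T -> R) (g h : T -> R).

Lemma sum_ffun_prod w :
  \sum_(f : {ffun I -> T}) \prod_i w i (f i) = \prod_i \sum_t w i t.
Proof. by rewrite bigA_distr_bigA. Qed.

Definition ffun_upd (f : {ffun I -> T}) (i : I) (t : T) : {ffun I -> T} :=
  [ffun j => if j == i then t else f j].

Lemma ffun_updE f i t j : ffun_upd f i t j = if j == i then t else f j.
Proof. by rewrite ffunE. Qed.

(* Swapping the [i]-th coordinate with an independent copy preserves the weight. *)
Lemma sum_ffun_indep w i g (E : {ffun I -> T} -> R) :
  \sum_t w i t = 1 ->
  (forall f t, E (ffun_upd f i t) = E f) ->
  \sum_(f : {ffun I -> T}) (\prod_j w j (f j)) * (g (f i) * E f) =
  (\sum_t w i t * g t) * \sum_(f : {ffun I -> T}) (\prod_j w j (f j)) * E f.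
Proof.
move=> w1 Eupd.
transitivity (\sum_(p : {ffun I -> T} * T)
    (\prod_j w j (p.1 j)) * w i p.2 * (g (p.1 i) * E p.1)).
  rewrite -(pair_bigA _ (fun (f : {ffun I -> T}) t =>
    (\prod_j w j (f j)) * w i t * (g (f i) * E f))) /=.
  apply: eq_bigr => f _; rewrite -mulr_suml -mulr_sumr w1 mulr1 //.
pose sw (p : {ffun I -> T} * T) := (ffun_upd p.1 i p.2, p.1 i).
have swK : involutive sw.
  case=> f t; rewrite /sw /= ffun_updE eqxx; congr pair.
  by apply/ffunP => j; rewrite !ffun_updE; case: eqP => // ->.
rewrite (reindex_inj (inv_inj swK)) /=.
rewrite mulr_sumr; under [RHS]eq_bigr => f _ do rewrite mulr_suml.
rewrite (pair_bigA _ (fun (f : {ffun I -> T}) t =>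
  w i t * g t * ((\prod_j w j (f j)) * E f))) /=.
apply: eq_bigr => -[f t] _ /=; rewrite ffun_updE eqxx Eupd.
rewrite (bigD1 i) //= [in RHS](bigD1 i) //= ffun_updE eqxx.
rewrite (eq_bigr (fun j => w j (f j))); last first.
  by move=> j /negbTE ji; rewrite ffun_updE ji.
ring.
Qed.

Lemma sum_ffun_marg w i g : (forall j, \sum_t w j t = 1) ->
  \sum_(f : {ffun I -> T}) (\prod_j w j (f j)) * g (f i) = \sum_t w i t * g t.
Proof.
move=> w1; under eq_bigr => f _ do rewrite -[g _]mulr1.
rewrite (@sum_ffun_indep w i g (fun=> 1)) //.
under [X in _ * X]eq_bigr => f _ do rewrite mulr1.
by rewrite sum_ffun_prod (eq_bigr (fun=> 1)) // big1_eq mulr1.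
Qed.

Lemma sum_ffun_marg2 w i j g h : i != j -> (forall k, \sum_t w k t = 1) ->
  \sum_(f : {ffun I -> T}) (\prod_k w k (f k)) * (g (f i) * h (f j)) =
  (\sum_t w i t * g t) * (\sum_t w j t * h t).
Proof.
move=> ij w1; rewrite (@sum_ffun_indep w i g (fun f => h (f j))) //.
  by rewrite sum_ffun_marg.
by move=> f t; rewrite ffun_updE eq_sym (negbTE ij).
Qed.

End ProductWeights.

Lemma sum_ffun_pair (R : nmodType) (I A B : finType)
  (F : {ffun I -> A} -> {ffun I -> B} -> R) :
  \sum_x \sum_y F x y =
  \sum_(t : {ffun I -> A * B}) F [ffun i => (t i).1] [ffun i => (t i).2].
Proof.
rewrite pair_bigA /=.
rewrite (reindex (fun t : {ffun I -> A * B} => ([ffun i => (t i).1], [ffun i => (t i).2]))) //=.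
exists (fun p : {ffun I -> A} * {ffun I -> B} => [ffun i => (p.1 i, p.2 i)]).
  by move=> t _; apply/ffunP => i; rewrite !ffunE /=; case: (t i).
by move=> [x y] _; congr pair; apply/ffunP => i; rewrite !ffunE.
Qed.

(** Derandomization: a bound on the error averaged over random codebooks is met by some codebook. *)
Lemma exists_le_mean (R : realType) (T : finType) (w F : T -> R) (b : R) :
  (forall t, 0 <= w t) -> \sum_t w t = 1 -> \sum_t w t * F t <= b ->
  exists t, F t <= b.
Proof.
move=> w0 w1 Fb; apply: contrapT => /forallNP Fgt.
have lt t : b < F t by rewrite ltNge; apply/negP/Fgt.
have eq t : w t * (F t - b) = 0.
  apply/eqP.
  have : \sum_t w t * (F t - b) <= 0.
    under eq_bigr => s _ do rewrite mulrBr.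
    by rewrite sumrB -mulr_suml w1 mul1r subr_le0.
  have ge0 s : 0 <= w s * (F s - b) by rewrite mulr_ge0 // subr_ge0 ltW.
  move=> le0; have /eqP : \sum_t w t * (F t - b) = 0.
    by apply/eqP; rewrite eq_le le0 sumr_ge0.
  by rewrite psumr_eq0 // => /allP /(_ t); rewrite mem_index_enum => /(_ isT).
have w00 t : w t = 0.
  by move/eqP: (eq t); rewrite mulf_eq0 subr_eq0 (gt_eqF (lt t)) orbF => /eqP.
by move/eqP: w1; rewrite big1 ?(eq_sym 0) ?oner_eq0.
Qed.

Section Entropy.
Variable R : realType.

(** Entropy summand in nats. It is also applied to unnormalized weights, for which [nxlnxM] plays
    the part of the chain rule. *)
Definition nxlnx (x : R) : R := - (x * ln x).

Lemma nxlnx0 : nxlnx 0 = 0. Proof. by rewrite /nxlnx mul0r oppr0. Qed.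

Lemma nxlnxM (x y : R) : 0 <= x -> 0 <= y -> nxlnx (x * y) = x * nxlnx y + y * nxlnx x.
Proof.
rewrite !le_eqVlt => /predU1P[<-|x0]; first by rewrite !mul0r nxlnx0 mulr0 add0r.
move=> /predU1P[<-|y0]; first by rewrite mulr0 nxlnx0 mulr0 mul0r addr0.
rewrite /nxlnx lnM //; ring.
Qed.

Lemma ln_le_sub1 (x : R) : 0 < x -> ln x <= x - 1.
Proof.
by move=> x0; have := @le_ln1Dx R (x - 1); rewrite (addrC 1) subrK; apply; rewrite ltrBrDl subrr.
Qed.

Lemma ln_ratio_le (p q : R) : 0 <= p -> 0 <= q -> (0 < p -> 0 < q) ->
  p * (ln q - ln p) <= q - p.
Proof.
rewrite le_eqVlt => /predU1P[<-|p0]; first by rewrite mul0r subr0.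
move=> _ /(_ p0) q0; rewrite -ln_div //.
apply: (@le_trans _ _ (p * (q / p - 1))).
  by rewrite ler_pM2l // ln_le_sub1 // divr_gt0.
by rewrite mulrBr mulr1 mulrCA divff ?gt_eqF // mulr1.
Qed.

(** Sum of the pointwise bound [ln_ratio_le]. Only total masses are compared, because the test laws
    used for Fano's inequality may have mass below one. *)
Lemma gibbs (T : finType) (p q : T -> R) :
  (forall t, 0 <= p t) -> (forall t, 0 <= q t) ->
  (forall t, 0 < p t -> 0 < q t) -> \sum_t q t <= \sum_t p t ->
  \sum_t p t * ln (q t) <= \sum_t p t * ln (p t).
Proof.
move=> p0 q0 pq le; rewrite -subr_le0 -sumrB.
apply: (@le_trans _ _ (\sum_t (q t - p t))).
  by apply: ler_sum => t _; rewrite -mulrBr ln_ratio_le // => /pq.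
by rewrite sumrB subr_le0.
Qed.

Lemma sum_eq0_ge0 (T : finType) (p : T -> R) : (forall t, 0 <= p t) ->
  \sum_t p t = 0 -> forall t, p t = 0.
Proof.
move=> p0 /eqP; rewrite psumr_eq0 // => /allP H t.
by have := H t; rewrite mem_index_enum => /(_ isT) /= /eqP.
Qed.

Lemma sum_gt0_ge (T : finType) (p : T -> R) (t : T) : (forall t, 0 <= p t) ->
  0 < p t -> 0 < \sum_t p t.
Proof.
move=> p0 pt; rewrite (bigD1 t) //= ltr_pwDl // sumr_ge0 //.
Qed.

(** The tangent of -x ln x at the mean [m] lies above the graph; its linear part averages to
    zero. *)
Lemma nxlnx_jensen (T : finType) (c r : T -> R) :
  (forall t, 0 <= c t) -> (forall t, 0 <= r t) -> \sum_t c t = 1 ->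
  \sum_t c t * nxlnx (r t) <= nxlnx (\sum_t c t * r t).
Proof.
move=> c0 r0 c1; set m := \sum_t c t * r t.
have cr0 t : 0 <= c t * r t by rewrite mulr_ge0.
have m0 : 0 <= m by apply: sumr_ge0.
have key : \sum_t c t * (r t * (ln m - ln (r t))) <= \sum_t c t * (m - r t).
  apply: ler_sum => t _; have [->|ct] := eqVneq (c t) 0; first by rewrite !mul0r.
  have ct0 : 0 < c t by rewrite lt_def ct c0.
  rewrite ler_pM2l // ln_ratio_le // => rt0.
  by apply: (@sum_gt0_ge T _ t) => //; rewrite mulr_gt0.
have e1 : \sum_t c t * (m - r t) = 0.
  under eq_bigr => t _ do rewrite mulrBr.
  by rewrite sumrB -mulr_suml c1 mul1r subrr.
move: key; rewrite e1.
have -> : \sum_t c t * (r t * (ln m - ln (r t))) =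
  m * ln m + \sum_t c t * nxlnx (r t).
  rewrite {1}/m mulr_suml -big_split /=; apply: eq_bigr => t _.
  rewrite /nxlnx; ring.
by rewrite addrC -lerBrDr sub0r.
Qed.

End Entropy.

(** * One-shot coding theorem *)

(** Change of measure. With [j] the joint weight at one fixed output, [j / \sum_s j s] is the
    posterior, and on [E] the prior is at most the posterior divided by [a]. The last hypothesis
    settles outputs of probability zero. *)
Lemma density_packing (R : realType) (T : finType) (p j : T -> R)
    (E : pred T) (a : R) :
  0 < a -> (forall t, 0 <= p t) -> (forall t, 0 <= j t) ->
  (forall t, E t -> a * (\sum_s j s) * p t <= j t) ->
  (forall t, E t -> p t != 0 -> j t != 0) ->
  \sum_t p t * (E t)%:R <= a^-1.
Proof.
move=> a0 p0 j0 Ej Enz; have : 0 <= \sum_s j s by apply: sumr_ge0.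
rewrite le_eqVlt => /predU1P[s0|s0].
  rewrite big1 ?invr_ge0 ?ltW // => t _.
  have [Et|] := boolP (E t); last by rewrite mulr0.
  rewrite mulr1; apply/eqP; apply: contraTT isT => /(Enz _ Et) /eqP[] //.
  by apply: sum_eq0_ge0.
have -> : a^-1 = (\sum_s j s) / (a * \sum_s j s).
  by rewrite invfM mulrCA divff ?gt_eqF // mulr1.
rewrite mulr_suml.
apply: ler_sum => t _; have [Et|_] := boolP (E t); last first.
  by rewrite mulr0 divr_ge0 // mulr_ge0 // ltW.
by rewrite mulr1 ler_pdivlMr ?mulr_gt0 // mulrC Ej.
Qed.

(** If [P < 1 / 2] the right side exceeds 1. Otherwise [q >= 1 / (2 * b)], and (1 - q)^L <= exp (- L
    q) <= 1 / (L q) suffices. *)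
Lemma covering_pow (R : realType) (q P b : R) (L : nat) :
  (0 < L)%N -> 0 < b -> 0 <= q <= 1 -> 0 <= P <= 1 -> P <= b * q ->
  (1 - q) ^+ L <= 2 * (1 - P) + 2 * b / L%:R.
Proof.
move=> L0 b0 /andP[q0 q1] /andP[P0 P1] Pq.
have Lr : 0 < L%:R :> R by rewrite ltr0n.
have t0 : 0 <= 2 * b / L%:R by rewrite divr_ge0 ?ler0n // mulr_ge0 // ltW.
have [P2|P2] := ltP P (1 / 2).
  apply: (@le_trans _ _ 1); first by rewrite exprn_ile1 ?subr_ge0 //; lra.
  lra.
have q_gt0 : 0 < q by rewrite -(pmulr_rgt0 _ b0); lra.
apply: (@le_trans _ _ (L%:R * q)^-1); last first.
  apply: (@le_trans _ _ (2 * b / L%:R)); last lra.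
  rewrite invfM mulrC ler_pM2r ?invr_gt0 //.
  rewrite -div1r ler_pdivrMr //; lra.
have h : 1 - q <= expR (- q) by rewrite -[1 - q]/(1 + - q) expR_ge1Dx.
apply: (@le_trans _ _ (expR (- q) ^+ L)); first by rewrite lerXn2r ?nnegrE ?subr_ge0 // expR_ge0.
rewrite -expRM_natl mulrN expRN lef_pV2 ?posrE ?expR_gt0 ?mulr_gt0 //.
apply: le_trans (expR_ge1Dx _); rewrite lerDr; lra.
Qed.

Section OneShot.
Variables (R : realType) (X Y U X2 Z : finType).
Variables (px : X -> R) (W2 : X -> Y -> R) (pu : X -> Y -> U -> R).
Variables (W3 : X -> X2 -> Y -> Z -> R) (f : U -> X -> Y -> X2).

Definition outY y := \sum_x px x * W2 x y.
Definition auxU x u := \sum_y W2 x y * pu x y u.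
(** This is p(u, z | x), jointly in u and z, so the density of I(X1,U;Y3) is
    [auxZ x u z / (auxU x u * outZ z)]. *)
Definition auxZ x u z := \sum_y W2 x y * pu x y u * W3 x (f u x y) y z.
Definition outZ z := \sum_x \sum_u px x * auxZ x u z.
Definition mean (F : X -> Y -> U -> Z -> R) :=
  \sum_x \sum_y \sum_u \sum_z
     px x * W2 x y * pu x y u * W3 x (f u x y) y z * F x y u z.

Hypothesis Hpx : is_pmf px.
Hypothesis HW2 : forall x, is_pmf (W2 x).
Hypothesis Hpu : forall x y, is_pmf (pu x y).
Hypothesis HW3 : forall x x2 y, is_pmf (W3 x x2 y).

Let px0 x : 0 <= px x. Proof. by case: Hpx. Qed.
Let W20 x y : 0 <= W2 x y. Proof. by case: (HW2 x). Qed.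
Let pu0 x y u : 0 <= pu x y u. Proof. by case: (Hpu x y). Qed.
Let W30 x x2 y z : 0 <= W3 x x2 y z. Proof. by case: (HW3 x x2 y). Qed.
Let px1 : \sum_x px x = 1. Proof. by case: Hpx. Qed.
Let W21 x : \sum_y W2 x y = 1. Proof. by case: (HW2 x). Qed.
Let pu1 x y : \sum_u pu x y u = 1. Proof. by case: (Hpu x y). Qed.
Let W31 x x2 y : \sum_z W3 x x2 y z = 1. Proof. by case: (HW3 x x2 y). Qed.

Lemma outY_ge0 y : 0 <= outY y.
Proof. by apply: sumr_ge0 => x _; rewrite mulr_ge0. Qed.

Lemma auxU_ge0 x u : 0 <= auxU x u.
Proof. by apply: sumr_ge0 => y _; rewrite mulr_ge0. Qed.

Lemma auxZ_ge0 x u z : 0 <= auxZ x u z.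
Proof. by apply: sumr_ge0 => y _; rewrite !mulr_ge0. Qed.

Lemma outZ_ge0 z : 0 <= outZ z.
Proof.
by apply: sumr_ge0 => x _; apply: sumr_ge0 => u _; rewrite mulr_ge0 // auxZ_ge0.
Qed.

Lemma sum_auxU x : \sum_u auxU x u = 1.
Proof.
rewrite exchange_big -[RHS](W21 x); apply: eq_bigr => y _.
by rewrite -mulr_sumr pu1 mulr1.
Qed.

Lemma mean_xyu (g : X -> Y -> U -> R) :
  mean (fun x y u _ => g x y u) =
  \sum_x \sum_y \sum_u px x * W2 x y * pu x y u * g x y u.
Proof.
apply: eq_bigr => x _; apply: eq_bigr => y _; apply: eq_bigr => u _.
by rewrite -mulr_suml -mulr_sumr W31 mulr1.
Qed.

Lemma mean_xy (g : X -> Y -> R) :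
  mean (fun x y _ _ => g x y) = \sum_x \sum_y px x * W2 x y * g x y.
Proof.
rewrite mean_xyu; apply: eq_bigr => x _; apply: eq_bigr => y _.
by rewrite -mulr_suml -mulr_sumr pu1 mulr1.
Qed.

Lemma mean_xuz (g : X -> U -> Z -> R) :
  mean (fun x _ u z => g x u z) = \sum_x \sum_u \sum_z px x * auxZ x u z * g x u z.
Proof.
apply: eq_bigr => x _; rewrite exchange_big; apply: eq_bigr => u _.
rewrite exchange_big; apply: eq_bigr => z _; rewrite mulr_sumr mulr_suml.
by apply: eq_bigr => y _; rewrite !mulrA.
Qed.

Lemma mean_ge0 F : (forall x y u z, 0 <= F x y u z) -> 0 <= mean F.
Proof.
by move=> F0; do 4 (apply: sumr_ge0 => ? _); rewrite !mulr_ge0.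
Qed.

Section Coding.
Variables (x20 : X2) (M L : nat) (l0 : 'I_L) (a b c e : R).
Hypotheses (a0 : 0 < a) (b0 : 0 < b) (c0 : 0 < c) (e0 : 0 < e).

Let B x y := a * outY y < W2 x y.
Let A x u z := c * auxU x u * outZ z < auxZ x u z.
Let miss x y u := \sum_z W3 x (f u x y) y z * (~~ A x u z)%:R.
(** The first condition lets u drawn from [auxU x] imitate u drawn from [pu x y]. The second makes
    any selected u pass the receiver's test up to probability [e], whatever rule selected it. *)
Let G x y u := (pu x y u <= b * auxU x u) && (miss x y u <= e).

(** A row gathers everything that belongs to one message. Its entries are dependent through the
    common x, but distinct rows are independent. *)
Let row := (X * {ffun 'I_L -> U})%type.
Let wrow (t : row) := px t.1 * \prod_l auxU t.1 (t.2 l).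
Let book := {ffun 'I_M -> row}.
Let wbook (C : book) := \prod_m wrow (C m).
(** The default [l0] is returned only on [noG], an event charged in full to the error. *)
Let sel (t : row) y := odflt l0 [pick l | G t.1 y (t.2 l)].
Let x2of (t : row) y := f (t.2 (sel t y)) t.1 y.

Let cenc (C : book) m := (C m).1.
Let crelay (C : book) y :=
  if [pick m | B (C m).1 y] is Some m then x2of (C m) y else x20.
Let cdec (C : book) z := [pick m | [exists l, A (C m).1 ((C m).2 l) z]].

Let noB (t : row) y := ~~ B t.1 y.
Let noG (t : row) y := [forall l, ~~ G t.1 y (t.2 l)].

Let wrow0 t : 0 <= wrow t.
Proof. by rewrite mulr_ge0 // prodr_ge0 // => l _; apply: auxU_ge0. Qed.

Let sum_wrow_x (g : X -> R) : \sum_t wrow t * g t.1 = \sum_x px x * g x.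
Proof.
rewrite -(pair_bigA _ (fun x us => wrow (x, us) * g x)) /=.
apply: eq_bigr => x _; rewrite -mulr_suml /wrow /= -mulr_sumr.
by rewrite (sum_ffun_prod (fun _ u => auxU x u)) big1 ?mulr1 // => l _; apply: sum_auxU.
Qed.

Let sum_wrow_u (l : 'I_L) (g : X -> U -> R) :
  \sum_t wrow t * g t.1 (t.2 l) = \sum_x \sum_u px x * auxU x u * g x u.
Proof.
rewrite -(pair_bigA _ (fun x (us : {ffun 'I_L -> U}) => wrow (x, us) * g x (us l))) /=.
apply: eq_bigr => x _; rewrite /wrow /=.
under eq_bigr => us _ do rewrite -mulrA.
rewrite -mulr_sumr (@sum_ffun_marg R _ _ (fun _ u => auxU x u) l) => [|_]; last exact: sum_auxU.
by rewrite mulr_sumr; apply: eq_bigr => u _; rewrite mulrA.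
Qed.

Let sum_wrow1 : \sum_t wrow t = 1.
Proof.
rewrite -px1 -[RHS](eq_bigr _ (fun x _ => mulr1 (px x))) -(sum_wrow_x (fun=> 1)).
by apply: eq_bigr => t _; rewrite mulr1.
Qed.

Let W2row (t : row) y := W2 t.1 y.

(* If the relay decodes [m] then [y3] depends on the codebook only through row [m]; this is what
   makes the other rows independent of [y3] in the last sum. *)
Let err_pointwise (C : book) m y :
  \sum_(z | cdec C z != Some m) W3 (C m).1 (crelay C y) y z <=
  (noB (C m) y)%:R + \sum_(m' | m' != m) (B (C m').1 y)%:R + (noG (C m) y)%:R + e
  + \sum_(m' | m' != m) \sum_l \sum_z
      W3 (C m).1 (x2of (C m) y) y z * (A (C m').1 ((C m').2 l) z)%:R.
Proof.
set s1 := \sum_(m' | _) _; set s2 := \sum_(m' | _) _.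
have s10 : 0 <= s1 by apply: sumr_ge0.
have s20 : 0 <= s2.
  by do 3 (apply: sumr_ge0 => ? _); rewrite mulr_ge0.
have le1 x x2 (Q : pred Z) : \sum_(z | Q z) W3 x x2 y z <= 1.
  by rewrite -(W31 x x2 y) [leRHS](bigID Q) /= lerDl sumr_ge0.
have e0' := ltW e0.
have [nB|] := boolP (noB (C m) y).
  apply: (le_trans (le1 _ _ _)); have := ler0n R (noG (C m) y); rewrite mulr1n; lra.
rewrite negbK => Bm.
have [/existsP[m' /andP[m'm Bm']]|] := boolP [exists m', (m' != m) && B (C m').1 y].
  apply: (le_trans (le1 _ _ _)).
  have : 1 <= s1 by rewrite /s1 (bigD1 m') //= Bm' lerDl sumr_ge0.
  have := ler0n R (noG (C m) y); rewrite mulr0n; lra.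
rewrite negb_exists => /forallP uniqB.
have -> : crelay C y = x2of (C m) y.
  rewrite /crelay; case: pickP => [m' Bm'|/(_ m)]; last by rewrite Bm.
  by have := uniqB m'; rewrite Bm' andbT negbK => /eqP ->.
have [nG|] := boolP (noG (C m) y).
  apply: (le_trans (le1 _ _ _)); rewrite mulr1n mulr0n; lra.
rewrite negb_forall => /existsP[l1]; rewrite negbK => Gl1.
have Gsel : G (C m).1 y ((C m).2 (sel (C m) y)).
  by rewrite /sel; case: pickP => [l //|/(_ l1)]; rewrite Gl1.
apply: (@le_trans _ _ (miss (C m).1 y ((C m).2 (sel (C m) y)) + s2)); last first.
  case/andP: Gsel => _ ?; rewrite !mulr0n; lra.
rewrite /s2; under [X in _ + X]eq_bigr => m' _ do rewrite exchange_big /=.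
rewrite exchange_big /= -big_split /= [leRHS](bigID (fun z => cdec C z != Some m)) /=.
rewrite -[leLHS]addr0 lerD //; last first.
  apply: sumr_ge0 => z _; rewrite addr_ge0 ?mulr_ge0 //.
  by do 2 (apply: sumr_ge0 => ? _); rewrite mulr_ge0.
apply: ler_sum => z dz; rewrite -/(x2of (C m) y).
have [Az|nAz] := boolP (A (C m).1 ((C m).2 (sel (C m) y)) z); last first.
  rewrite mulr1 lerDl; apply: sumr_ge0 => ? _; apply: sumr_ge0 => ? _; rewrite mulr_ge0 //.
rewrite mulr0 add0r.
(* Row [m] passes the test at [z], so the search returns a message; an error means that it is some
   [m' != m], already counted in [s2]. *)
move: dz; rewrite /cdec; case: pickP => [m' /existsP[l Al]|/(_ m)]; last first.
  by move=> /negbT; rewrite negb_exists => /forallP /(_ (sel (C m) y)); rewrite Az.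
move=> m'm; have {}m'm : m' != m by apply: contra m'm => /eqP ->.
rewrite (bigD1 m') //= (bigD1 l) //= Al mulr1 -addrA lerDl.
rewrite addr_ge0 //; last by do 2 (apply: sumr_ge0 => ? _); rewrite mulr_ge0.
by apply: sumr_ge0 => ? _; rewrite mulr_ge0.
Qed.


Let wbook0 C : 0 <= wbook C.
Proof. by rewrite prodr_ge0. Qed.

Let sum_wbook1 (m : 'I_M) (g : row -> R) :
  \sum_C wbook C * g (C m) = \sum_t wrow t * g t.
Proof. by rewrite (@sum_ffun_marg R _ _ (fun _ t => wrow t)). Qed.

Let sum_wbook2 (m m' : 'I_M) (g h : row -> R) : m != m' ->
  \sum_C wbook C * (g (C m) * h (C m')) =
  (\sum_t wrow t * g t) * (\sum_t wrow t * h t).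
Proof. by move=> mm'; rewrite (@sum_ffun_marg2 R _ _ (fun _ t => wrow t)). Qed.

Let term_noB (m : 'I_M) :
  \sum_C wbook C * (\sum_y W2row (C m) y * (noB (C m) y)%:R) =
  mean (fun x y _ _ => (W2 x y <= a * outY y)%R%:R).
Proof.
rewrite (sum_wbook1 m (fun t => \sum_y W2row t y * (noB t y)%:R)).
rewrite (sum_wrow_x (fun x => \sum_y W2 x y * (~~ B x y)%:R)) mean_xy.
apply: eq_bigr => x _; rewrite mulr_sumr; apply: eq_bigr => y _.
by rewrite mulrA /B -leNgt.
Qed.

(** Union bound over the other rows: each is independent of the y produced by row [m], so packing
    gives [a^-1] for every fixed y. *)
Let term_B (m : 'I_M) :
  \sum_C wbook C * (\sum_y W2row (C m) y * \sum_(m' | m' != m) (B (C m').1 y)%:R)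
  <= M%:R * a^-1.
Proof.
have -> : \sum_C wbook C * (\sum_y W2row (C m) y * \sum_(m' | m' != m) (B (C m').1 y)%:R)
  = \sum_(m' | m' != m) \sum_y
      \sum_C wbook C * (W2row (C m) y * (B (C m').1 y)%:R).
  under eq_bigr => C _ do rewrite mulr_sumr.
  rewrite exchange_big [RHS]exchange_big; apply: eq_bigr => y _ /=.
  rewrite [RHS]exchange_big; apply: eq_bigr => C _ /=.
  by rewrite mulr_sumr mulr_sumr.
have -> : M%:R * a^-1 = \sum_(m' < M) a^-1 by rewrite sumr_const card_ord mulr_natl.
rewrite [leRHS](bigID (fun m' => m' != m)) /= -[leLHS]addr0.
have ia : 0 <= a^-1 by rewrite invr_ge0 ltW.
rewrite lerD ?sumr_ge0 //; apply: ler_sum => m' m'm.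
have -> : a^-1 = \sum_y outY y * a^-1.
  rewrite -mulr_suml /outY exchange_big /=.
  rewrite (eq_bigr px) ?px1 ?mul1r // => x _.
  by rewrite -mulr_sumr W21 mulr1.
apply: ler_sum => y _.
rewrite (@sum_wbook2 m m' (fun t => W2row t y) (fun t => (B t.1 y)%:R)) 1?eq_sym //.
rewrite (sum_wrow_x (fun x => W2 x y)) (sum_wrow_x (fun x => (B x y)%:R)).
rewrite ler_wpM2l ?outY_ge0 //.
apply: (@density_packing R X px (fun x => px x * W2 x y) (fun x => B x y)) => //.
- by move=> x; rewrite mulr_ge0.
- by move=> x Bx; rewrite mulrC ler_wpM2l // ltW.
- move=> x Bx pxn; rewrite mulf_neq0 // gt_eqF //.
  by apply: le_lt_trans Bx; rewrite mulr_ge0 ?outY_ge0 // ltW.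
Qed.

(** Given (x, y) the entries u(m, l) are i.i.d., so the probability that all are unsuitable is an
    L-th power, to which [covering_pow] applies. Unsuitability under the true law of u is then split
    into a density above [b] and [miss > e]; Markov's inequality for the latter produces [e^-1]. *)
Let term_noG (m : 'I_M) :
  \sum_C wbook C * (\sum_y W2row (C m) y * (noG (C m) y)%:R) <=
  2 * (mean (fun x y u _ => (b * auxU x u < pu x y u)%R%:R) +
       e^-1 * mean (fun x _ u z => (auxZ x u z <= c * auxU x u * outZ z)%R%:R))
  + 2 * b / L%:R.
Proof.
rewrite (sum_wbook1 m (fun t => \sum_y W2row t y * (noG t y)%:R)).
have -> : \sum_t wrow t * (\sum_y W2row t y * (noG t y)%:R) =
    \sum_x \sum_y px x * W2 x y * (1 - \sum_u auxU x u * (G x y u)%:R) ^+ L.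
  rewrite -(pair_bigA _ (fun x us => wrow (x, us) * \sum_y W2row (x, us) y * (noG (x, us) y)%:R)) /=.
  apply: eq_bigr => x _; under eq_bigr => us _ do rewrite mulr_sumr.
  rewrite exchange_big; apply: eq_bigr => y _ /=.
  have -> : 1 - \sum_u auxU x u * (G x y u)%:R = \sum_u auxU x u * (~~ G x y u)%:R.
    rewrite -{1}(sum_auxU x) -sumrB; apply: eq_bigr => u _.
    by case: (G x y u); rewrite ?mulr1 ?mulr0 ?subrr ?subr0.
  rewrite -[in RHS](card_ord L) -prodr_const.
  rewrite -(sum_ffun_prod (fun (_ : 'I_L) u => auxU x u * (~~ G x y u)%:R)) mulr_sumr.
  apply: eq_bigr => us _; rewrite /wrow /W2row /= big_split /= -!mulrA; congr (_ * _).
  rewrite mulrCA; congr (_ * (_ * _)); rewrite -natr_prod; congr _%:R.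
  have [/forallP nG|] := boolP (noG _ _); first by rewrite big1 // => l _; rewrite nG.
  rewrite negb_forall => /existsP[l /negbTE nG]; apply/eqP; rewrite eq_sym.
  by rewrite (bigD1 l) //= nG.
have L0 : (0 < L)%N by apply: leq_ltn_trans (ltn_ord l0).
have G1 x y : 0 <= \sum_u pu x y u * (G x y u)%:R <= 1.
  rewrite sumr_ge0 => [|u _]; last by rewrite mulr_ge0.
  rewrite -[leRHS](pu1 x y); apply: ler_sum => u _; case: (G x y u); rewrite ?mulr1 ?mulr0 //.
have A1 x y : 0 <= \sum_u auxU x u * (G x y u)%:R <= 1.
  rewrite sumr_ge0 => [|u _]; last by rewrite mulr_ge0 ?auxU_ge0.
  rewrite -[leRHS](sum_auxU x); apply: ler_sum => u _; case: (G x y u); rewrite ?mulr1 ?mulr0 ?auxU_ge0 //.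
have bL : 2 * b / L%:R = \sum_x \sum_y px x * W2 x y * (2 * b / L%:R).
  under eq_bigr => x _ do rewrite -mulr_suml -mulr_sumr W21 mulr1.
  by rewrite -mulr_suml px1 mul1r.
apply: (@le_trans _ _ (\sum_x \sum_y px x * W2 x y *
    (2 * (1 - \sum_u pu x y u * (G x y u)%:R) + 2 * b / L%:R))).
  apply: ler_sum => x _; apply: ler_sum => y _; rewrite ler_wpM2l ?mulr_ge0 //.
  apply: covering_pow => //.
  rewrite mulr_sumr; apply: ler_sum => u _.
  have [/andP[Gu _]|_] := boolP (G x y u); last by rewrite !mulr0.
  by rewrite !mulr1.
rewrite [in leRHS]bL.
under eq_bigr => x _ do (under eq_bigr => y _ do rewrite mulrDr; rewrite big_split).
rewrite big_split /= lerD2r.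
rewrite mean_xyu mean_xuz !mulr_sumr -big_split /= mulr_sumr; apply: ler_sum => x _.
have -> : e^-1 * (\sum_u \sum_z px x * auxZ x u z *
       (auxZ x u z <= c * auxU x u * outZ z)%R%:R) =
    \sum_y \sum_u px x * W2 x y * pu x y u * (e^-1 * miss x y u).
  rewrite [RHS]exchange_big mulr_sumr.
  apply: eq_bigr => u _ /=.
  rewrite /miss; under [RHS]eq_bigr => y _ do rewrite !mulr_sumr.
  rewrite [RHS]exchange_big mulr_sumr; apply: eq_bigr => z _ /=.
  rewrite -leNgt {1}/auxZ mulr_sumr mulr_suml mulr_sumr.
  by apply: eq_bigr => y _; ring.
rewrite -big_split mulr_sumr; apply: ler_sum => y _ /=.
rewrite -big_split /= mulrCA ler_pM2l // -[X in X - _](pu1 x y) -sumrB mulr_sumr.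
apply: ler_sum => u _; rewrite -!mulrA -!mulrDr !ler_wpM2l //.
rewrite -{1}[pu x y u]mulr1 -mulrBr ler_wpM2l //.
have m0 : 0 <= miss x y u by apply: sumr_ge0 => z _; rewrite mulr_ge0.
have [_|] := boolP (G x y u); first by rewrite subrr addr_ge0 // mulr_ge0 // invr_ge0 ltW.
rewrite /G negb_and -!ltNge subr0 => /orP[->|em].
  by rewrite lerDl mulr_ge0 // invr_ge0 ltW.
apply: (@le_trans _ _ (e^-1 * miss x y u)); last by rewrite lerDr.
by rewrite mulrC ler_pdivlMr // mul1r ltW.
Qed.

(** The z caused by row [m] does not follow the single-letter law [outZ], since the relay selects u.
    This is harmless: packing bounds the probability that another row passes by [c^-1] at each fixed
    z, and the law [q] of z only averages these bounds. *)
Let term_A (m : 'I_M) :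
  \sum_C wbook C * (\sum_y W2row (C m) y * \sum_(m' | m' != m) \sum_l \sum_z
      W3 (C m).1 (x2of (C m) y) y z * (A (C m').1 ((C m').2 l) z)%:R)
  <= M%:R * L%:R / c.
Proof.
pose q (t : row) z := \sum_y W2row t y * W3 t.1 (x2of t y) y z.
have -> : \sum_C wbook C * (\sum_y W2row (C m) y * \sum_(m' | m' != m) \sum_l \sum_z
      W3 (C m).1 (x2of (C m) y) y z * (A (C m').1 ((C m').2 l) z)%:R)
  = \sum_(m' | m' != m) \sum_l \sum_z
      \sum_C wbook C * (q (C m) z * (A (C m').1 ((C m').2 l) z)%:R).
  transitivity (\sum_C \sum_(m' | m' != m) \sum_l \sum_z
      wbook C * (q (C m) z * (A (C m').1 ((C m').2 l) z)%:R)).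
    apply: eq_bigr => C _.
    under [X in _ * X]eq_bigr => y _ do rewrite mulr_sumr.
    rewrite exchange_big mulr_sumr; apply: eq_bigr => m' _ /=.
    under [X in _ * X]eq_bigr => y _ do rewrite mulr_sumr.
    rewrite exchange_big mulr_sumr; apply: eq_bigr => l _ /=.
    under [X in _ * X]eq_bigr => y _ do rewrite mulr_sumr.
    rewrite exchange_big mulr_sumr; apply: eq_bigr => z _ /=.
    by congr (_ * _); rewrite mulr_suml; apply: eq_bigr => y _; rewrite mulrA.
  rewrite exchange_big; apply: eq_bigr => m' _.
  rewrite exchange_big; apply: eq_bigr => l _.
  by rewrite exchange_big.
have ic : 0 <= c^-1 by rewrite invr_ge0 ltW.
have -> : M%:R * L%:R / c = \sum_(m' < M) \sum_(l < L) c^-1.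
  by rewrite sumr_const card_ord sumr_const card_ord -mulrnA -[RHS]mulr_natl natrM [L%:R * _]mulrC.
rewrite [leRHS](bigID (fun m' => m' != m)) /= -[leLHS]addr0.
rewrite lerD ?sumr_ge0 //.
apply: ler_sum => m' m'm; apply: ler_sum => l _.
have qE : \sum_z \sum_t wrow t * q t z = 1.
  rewrite exchange_big -sum_wrow1; apply: eq_bigr => t _ /=.
  rewrite -mulr_sumr exchange_big /= -[RHS]mulr1; congr (_ * _).
  by rewrite -(W21 t.1); apply: eq_bigr => y _; rewrite -mulr_sumr W31 mulr1.
have -> : c^-1 = (\sum_z \sum_t wrow t * q t z) * c^-1 by rewrite qE mul1r.
rewrite mulr_suml; apply: ler_sum => z _.
rewrite (@sum_wbook2 m m' (fun t => q t z) (fun t => (A t.1 (t.2 l) z)%:R)) 1?eq_sym //.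
rewrite (sum_wrow_u l (fun x u => (A x u z)%:R)).
rewrite ler_wpM2l //.
  apply: sumr_ge0 => t _; rewrite mulr_ge0 //; apply: sumr_ge0 => y _.
  by rewrite mulr_ge0 // W20.
rewrite pair_bigA /=.
apply: (@density_packing R _ (fun xu : X * U => px xu.1 * auxU xu.1 xu.2)
   (fun xu => px xu.1 * auxZ xu.1 xu.2 z) (fun xu => A xu.1 xu.2 z)) => //.
- by move=> xu; rewrite mulr_ge0 ?auxU_ge0.
- by move=> xu; rewrite mulr_ge0 ?auxZ_ge0.
- move=> [x u] Axu /=; rewrite -(pair_bigA _ (fun x u => px x * auxZ x u z)) /=.
  rewrite -/(outZ z) mulrCA ler_wpM2l //; apply: le_trans (ltW Axu).
  by rewrite mulrAC.
- move=> [x u] Axu /=; rewrite !mulf_eq0 !negb_or => /andP[-> _] /=.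
  by rewrite gt_eqF //; apply: le_lt_trans Axu; rewrite !mulr_ge0 ?auxU_ge0 ?outZ_ge0 // ltW.
Qed.

(* The terms are, in order: the relay misses [m] or finds another message (threshold [a]); no
   [u(m, l)] suits the relay (covering at density [b], or conditional receiver error above [e]);
   residual receiver error; another pair [(m', l)] passes the receiver's test (threshold [c]). *)
Definition one_shot_bound :=
  mean (fun x y _ _ => (W2 x y <= a * outY y)%R%:R) + M%:R * a^-1 +
  (2 * (mean (fun x y u _ => (b * auxU x u < pu x y u)%R%:R) +
       e^-1 * mean (fun x _ u z => (auxZ x u z <= c * auxU x u * outZ z)%R%:R))
  + 2 * b / L%:R) + e + M%:R * L%:R / c.

Lemma one_shot : exists (enc : 'I_M -> X) (relay : Y -> X2) (dec : Z -> option 'I_M),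
  M%:R^-1 * (\sum_m \sum_y \sum_(z | dec z != Some m)
     W2 (enc m) y * W3 (enc m) (relay y) y z) <=
  one_shot_bound.
Proof.
set bnd := one_shot_bound.
have bnd0 : 0 <= bnd.
  have := @mean_ge0 (fun x y _ _ => (W2 x y <= a * outY y)%R%:R) (fun _ _ _ _ => ler0n _ _).
  have := @mean_ge0 (fun x y u _ => (b * auxU x u < pu x y u)%R%:R) (fun _ _ _ _ => ler0n _ _).
  have := @mean_ge0 (fun x _ u z => (auxZ x u z <= c * auxU x u * outZ z)%R%:R) (fun _ _ _ _ => ler0n _ _).
  move=> ? ? ?; rewrite /bnd /one_shot_bound !addr_ge0 ?mulr_ge0 ?invr_ge0 ?addr_ge0 ?mulr_ge0 ?invr_ge0 ?ler0n ?(ltW a0) ?(ltW b0) ?(ltW c0) ?(ltW e0) //.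
pose err (C : book) m := \sum_y \sum_(z | cdec C z != Some m)
     W2 (C m).1 y * W3 (C m).1 (crelay C y) y z.
suff [C errC] : exists C : book, M%:R^-1 * \sum_m err C m <= bnd.
  by exists (cenc C), (crelay C), (cdec C).
apply: (@exists_le_mean R _ wbook) => //.
  by rewrite (sum_ffun_prod (fun (_ : 'I_M) t => wrow t)) big1.
have errm m : \sum_C wbook C * err C m <= bnd.
  rewrite /bnd /one_shot_bound -(term_noB m).
  apply: (@le_trans _ _ (
   \sum_C wbook C * (\sum_y W2row (C m) y * (noB (C m) y)%:R)
   + \sum_C wbook C * (\sum_y W2row (C m) y * \sum_(m' | m' != m) (B (C m').1 y)%:R)
   + \sum_C wbook C * (\sum_y W2row (C m) y * (noG (C m) y)%:R) + e
   + \sum_C wbook C * (\sum_y W2row (C m) y * \sum_(m' | m' != m) \sum_l \sum_z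
      W3 (C m).1 (x2of (C m) y) y z * (A (C m').1 ((C m').2 l) z)%:R))); last first.
    apply: lerD; last exact: term_A.
    by rewrite lerD2r; apply: lerD; [apply: lerD => //; apply: term_B|apply: term_noG].
  have -> : e = \sum_C wbook C * (\sum_y W2row (C m) y * e).
    have eC (C : book) : wbook C * (\sum_y W2row (C m) y * e) = wbook C * e.
      by rewrite -mulr_suml W21 mul1r.
    rewrite (eq_bigr _ (fun C _ => eC C)) -mulr_suml.
    by rewrite (sum_ffun_prod (fun (_ : 'I_M) t => wrow t)) big1 ?mul1r.
  rewrite -!big_split; apply: ler_sum => C _ /=; rewrite -!mulrDr ler_wpM2l //.
  rewrite -!big_split; apply: ler_sum => y _ /=; rewrite -!mulrDr -mulr_sumr.
  by rewrite ler_wpM2l ?W20 // err_pointwise.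
under eq_bigr => C _ do rewrite mulrCA mulr_sumr.
rewrite -mulr_sumr exchange_big /=.
have [->|Mn] := eqVneq (M%:R : R) 0; first by rewrite invr0 mul0r.
have M0 : 0 < M%:R :> R by rewrite lt_def Mn ler0n.
rewrite mulrC ler_pdivrMr //.
have -> : bnd * M%:R = \sum_(m < M) bnd by rewrite sumr_const card_ord mulr_natr.
by apply: ler_sum => m _; apply: errm.
Qed.

End Coding.
End OneShot.

(** * Block laws *)

Section IID.
Variables (R : realType) (T : finType) (P : T -> R) (n : nat).
Hypothesis HP : is_pmf P.

Let P0 t : 0 <= P t. Proof. by case: HP. Qed.
Let P1 : \sum_t P t = 1. Proof. by case: HP. Qed.

Lemma iid_variance (psi : T -> R) : \sum_t P t * psi t = 0 ->
  \sum_(t : {ffun 'I_n -> T}) (\prod_i P (t i)) * (\sum_i psi (t i)) ^+ 2 =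
  n%:R * \sum_t P t * psi t ^+ 2.
Proof.
move=> psi0.
transitivity (\sum_(i < n) \sum_(j < n) \sum_(t : {ffun 'I_n -> T})
    (\prod_k P (t k)) * (psi (t i) * psi (t j))).
  under [RHS]eq_bigr => i _ do rewrite exchange_big.
  rewrite exchange_big; apply: eq_bigr => t _ /=.
  rewrite expr2 mulr_suml mulr_sumr; apply: eq_bigr => i _.
  by rewrite mulr_sumr mulr_sumr.
have -> : n%:R * \sum_t P t * psi t ^+ 2 = \sum_(i < n) \sum_t P t * psi t ^+ 2.
  by rewrite sumr_const card_ord mulr_natl.
apply: eq_bigr => i _; rewrite (bigD1 i) //= [X in _ + X]big1 ?addr0 => [|j ji].
  rewrite (@sum_ffun_marg R _ _ (fun _ t => P t) i (fun t => psi t * psi t)) //.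
by rewrite (@sum_ffun_marg2 R _ _ (fun _ t => P t) i j psi psi) ?psi0 ?mul0r // eq_sym.
Qed.

(** The event is compared with the deviation only on sequences of positive weight, where log
    densities have their meaning. *)
Lemma iid_chebyshev (psi : T -> R) (d : R) (E : pred {ffun 'I_n -> T}) :
  (0 < n)%N -> 0 < d -> \sum_t P t * psi t = 0 ->
  (forall t : {ffun 'I_n -> T}, (forall i, 0 < P (t i)) -> E t ->
     n%:R * d <= `| \sum_i psi (t i) |) ->
  \sum_(t : {ffun 'I_n -> T}) (\prod_i P (t i)) * (E t)%:R <=
  (\sum_t P t * psi t ^+ 2) / d ^+ 2 / n%:R.
Proof.
move=> n0 d0 psi0 HE; have nr : 0 < n%:R :> R by rewrite ltr0n.
have nd : 0 < n%:R * d by rewrite mulr_gt0.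
have -> : (\sum_t P t * psi t ^+ 2) / d ^+ 2 / n%:R =
  (n%:R * \sum_t P t * psi t ^+ 2) / (n%:R * d) ^+ 2.
  by field; rewrite !gt_eqF.
rewrite -iid_variance // mulr_suml; apply: ler_sum => t _.
rewrite -mulrA.
have Pt0 : 0 <= \prod_i P (t i) by apply: prodr_ge0.
have [->|Pn] := eqVneq (\prod_i P (t i)) 0; first by rewrite !mul0r.
have Pi i : 0 < P (t i).
  by rewrite lt_def P0 andbT; move/prodf_neq0: Pn; apply.
rewrite ler_wpM2l //; have [Et|_] := boolP (E t); last first.
  by rewrite divr_ge0 // sqr_ge0.
rewrite ler_pdivlMr ?exprn_gt0 // mul1r -[leRHS](ger0_norm (sqr_ge0 _)) normrX.
by rewrite lerXn2r ?nnegrE ?normr_ge0 ?(ltW nd) // HE.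
Qed.

Lemma ln_prod (g : 'I_n -> R) : (forall i, 0 < g i) ->
  ln (\prod_i g i) = \sum_i ln (g i).
Proof.
move=> g0; suff [] : 0 < \prod_i g i /\ ln (\prod_i g i) = \sum_i ln (g i) by [].
apply: (big_ind2 (fun p s => 0 < p /\ ln p = s)) => //.
- by rewrite ln1.
- by move=> p s p' s' [p0 <-] [p0' <-]; rewrite mulr_gt0 // lnM.
Qed.

(** The event is stated with products, in the shape in which the threshold tests of the one-shot
    bound appear for blocks. *)
Lemma iid_density (g1 g2 : T -> R) (mu d : R) :
  (0 < n)%N -> 0 < d ->
  (forall t, 0 < P t -> 0 < g1 t /\ 0 < g2 t) ->
  \sum_t P t * (ln (g1 t) - ln (g2 t)) = mu ->
  \sum_(t : {ffun 'I_n -> T}) (\prod_i P (t i)) *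
    (\prod_i g1 (t i) <= expR (n%:R * (mu - d)) * \prod_i g2 (t i))%R%:R <=
  (\sum_t P t * (ln (g1 t) - ln (g2 t) - mu) ^+ 2) / d ^+ 2 / n%:R.
Proof.
move=> n0 d0 g0 Emu; apply: (@iid_chebyshev (fun t => ln (g1 t) - ln (g2 t) - mu)
  d (fun t => \prod_i g1 (t i) <= expR (n%:R * (mu - d)) * \prod_i g2 (t i))) => //.
  under eq_bigr => t _ do rewrite mulrBr.
  by rewrite sumrB -mulr_suml P1 mul1r Emu subrr.
move=> t Pt; have g10 i : 0 < g1 (t i) by case: (g0 _ (Pt i)).
have g20 i : 0 < g2 (t i) by case: (g0 _ (Pt i)).
rewrite -ler_ln ?posrE ?mulr_gt0 ?expR_gt0 ?prodr_gt0 //.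
rewrite lnM ?posrE ?expR_gt0 ?prodr_gt0 // expRK !ln_prod // => le.
rewrite !sumrB sumr_const card_ord -mulr_natl.
rewrite ler_normr; apply/orP; right; move: le; lra.
Qed.

End IID.

Section Block.
Variables (R : realType) (X Y U X2 Z : finType).
Variables (px : X -> R) (W2 : X -> Y -> R) (pu : X -> Y -> U -> R).
Variables (W3 : X -> X2 -> Y -> Z -> R) (f : U -> X -> Y -> X2).
Hypothesis Hpx : is_pmf px.
Hypothesis HW2 : forall x, is_pmf (W2 x).
Hypothesis Hpu : forall x y, is_pmf (pu x y).
Hypothesis HW3 : forall x x2 y, is_pmf (W3 x x2 y).

Definition pxn n (x : {ffun 'I_n -> X}) := \prod_i px (x i).
Definition W2n n (x : {ffun 'I_n -> X}) (y : {ffun 'I_n -> Y}) := \prod_i W2 (x i) (y i).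
Definition pun n (x : {ffun 'I_n -> X}) (y : {ffun 'I_n -> Y}) (u : {ffun 'I_n -> U}) :=
  \prod_i pu (x i) (y i) (u i).
Definition W3n n (x : {ffun 'I_n -> X}) (x2 : {ffun 'I_n -> X2}) (y : {ffun 'I_n -> Y})
  (z : {ffun 'I_n -> Z}) := \prod_i W3 (x i) (x2 i) (y i) (z i).
Definition fn n (u : {ffun 'I_n -> U}) (x : {ffun 'I_n -> X}) (y : {ffun 'I_n -> Y}) :
  {ffun 'I_n -> X2} := [ffun i => f (u i) (x i) (y i)].

Lemma is_pmf_prod (I T : finType) (w : I -> T -> R) : (forall i, is_pmf (w i)) ->
  is_pmf (fun t : {ffun I -> T} => \prod_i w i (t i)).
Proof.
move=> Hw; split => [t|]; first by apply: prodr_ge0 => i _; case: (Hw i).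
by rewrite sum_ffun_prod big1 // => i _; case: (Hw i).
Qed.

Variable n : nat.

Lemma outYn y : outY (@pxn n) (@W2n n) y = \prod_i outY px W2 (y i).
Proof.
rewrite -(sum_ffun_prod (fun i x => px x * W2 x (y i))).
by apply: eq_bigr => x _; rewrite big_split.
Qed.

Lemma auxUn x u : auxU (@W2n n) (@pun n) x u = \prod_i auxU W2 pu (x i) (u i).
Proof.
rewrite -(sum_ffun_prod (fun i y => W2 (x i) y * pu (x i) y (u i))).
by apply: eq_bigr => y _; rewrite big_split.
Qed.

Lemma auxZn x u z : auxZ (@W2n n) (@pun n) (@W3n n) (@fn n) x u z =
  \prod_i auxZ W2 pu W3 f (x i) (u i) (z i).
Proof.
rewrite -(sum_ffun_prod (fun i y => W2 (x i) y * pu (x i) y (u i) *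
  W3 (x i) (f (u i) (x i) y) y (z i))).
apply: eq_bigr => y _; rewrite !big_split /=; congr (_ * _).
by apply: eq_bigr => i _; rewrite ffunE.
Qed.

Lemma outZn z : outZ (@pxn n) (@W2n n) (@pun n) (@W3n n) (@fn n) z =
  \prod_i outZ px W2 pu W3 f (z i).
Proof.
rewrite -(sum_ffun_prod (fun i x => \sum_u px x * auxZ W2 pu W3 f x u (z i))).
apply: eq_bigr => x _.
rewrite -(sum_ffun_prod (fun i u => px (x i) * auxZ W2 pu W3 f (x i) u (z i))).
by apply: eq_bigr => u _; rewrite auxZn big_split.
Qed.

Definition jointP (t : X * Y * U * Z) :=
  px t.1.1.1 * W2 t.1.1.1 t.1.1.2 * pu t.1.1.1 t.1.1.2 t.1.2 *
  W3 t.1.1.1 (f t.1.2 t.1.1.1 t.1.1.2) t.1.1.2 t.2.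

Lemma sum_jointP (F : X -> Y -> U -> Z -> R) :
  \sum_t jointP t * F t.1.1.1 t.1.1.2 t.1.2 t.2 = mean px W2 pu W3 f F.
Proof.
rewrite /mean pair_bigA pair_bigA pair_bigA /=; apply: eq_bigr => -[[[x y] u] z] _ //.
Qed.

Lemma jointP_pmf : is_pmf jointP.
Proof.
split=> [t|].
  by rewrite !mulr_ge0; case: Hpx (HW2 t.1.1.1) (Hpu t.1.1.1 t.1.1.2)
    (HW3 t.1.1.1 (f t.1.2 t.1.1.1 t.1.1.2) t.1.1.2) => ? _ [? _] [? _] [? _].
transitivity (\sum_t jointP t * 1); first by apply: eq_bigr => *; rewrite mulr1.
rewrite (sum_jointP (fun _ _ _ _ => 1)) (mean_xy px W2 f Hpu HW3 (fun _ _ => 1)).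
transitivity (\sum_x px x); last by case: Hpx.
apply: eq_bigr => x _; under eq_bigr => y _ do rewrite mulr1.
by rewrite -mulr_sumr; case: (HW2 x) => _ ->; rewrite mulr1.
Qed.

Lemma meann (F : {ffun 'I_n -> X} -> {ffun 'I_n -> Y} -> {ffun 'I_n -> U} ->
    {ffun 'I_n -> Z} -> R) :
  mean (@pxn n) (@W2n n) (@pun n) (@W3n n) (@fn n) F =
  \sum_(t : {ffun 'I_n -> X * Y * U * Z}) (\prod_i jointP (t i)) *
    F [ffun i => (t i).1.1.1] [ffun i => (t i).1.1.2] [ffun i => (t i).1.2]
      [ffun i => (t i).2].
Proof.
rewrite /mean sum_ffun_pair sum_ffun_pair sum_ffun_pair.
apply: eq_bigr => t _.
have h1 : [ffun i => ([ffun i0 => ([ffun i1 => (t i1).1] i0).1] i).1] = [ffun i => (t i).1.1.1].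
  by apply/ffunP => i; rewrite !ffunE.
have h2 : [ffun i => ([ffun i0 => ([ffun i1 => (t i1).1] i0).1] i).2] = [ffun i => (t i).1.1.2].
  by apply/ffunP => i; rewrite !ffunE.
have h3 : [ffun i => ([ffun i0 => (t i0).1] i).2] = [ffun i => (t i).1.2].
  by apply/ffunP => i; rewrite !ffunE.
rewrite h1 h2 h3; congr (_ * _); rewrite /pxn /W2n /pun /W3n -!big_split /=.
by apply: eq_bigr => i _; rewrite !ffunE.
Qed.

End Block.

(** * Block codes with vanishing error *)

Section Achievability.
Variables (R : realType) (X Y U X2 Z : finType).
Variables (px : X -> R) (W2 : X -> Y -> R) (pu : X -> Y -> U -> R).
Variables (W3 : X -> X2 -> Y -> Z -> R) (f : U -> X -> Y -> X2).
Hypothesis Hpx : is_pmf px.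
Hypothesis HW2 : forall x, is_pmf (W2 x).
Hypothesis Hpu : forall x y, is_pmf (pu x y).
Hypothesis HW3 : forall x x2 y, is_pmf (W3 x x2 y).

Let P := jointP px W2 pu W3 f.
Let gW2 (t : X * Y * U * Z) := W2 t.1.1.1 t.1.1.2.
Let gY (t : X * Y * U * Z) := outY px W2 t.1.1.2.
Let gpu (t : X * Y * U * Z) := pu t.1.1.1 t.1.1.2 t.1.2.
Let gU (t : X * Y * U * Z) := auxU W2 pu t.1.1.1 t.1.2.
Let gXUZ (t : X * Y * U * Z) := auxZ W2 pu W3 f t.1.1.1 t.1.2 t.2.
Let gZ (t : X * Y * U * Z) := outZ px W2 pu W3 f t.2.

(** These are I(X1;Y2), I(Y2;U|X1) and I(X1,U;Y3) in nats, as means of log densities from which the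
    common factor [px] has been cancelled. *)
Definition info_XY := \sum_t P t * (ln (gW2 t) - ln (gY t)).
Definition info_YU := \sum_t P t * (ln (gpu t) - ln (gU t)).
Definition info_XUZ := \sum_t P t * (ln (gXUZ t) - ln (gU t * gZ t)).

Let px0 x : 0 <= px x. Proof. by case: Hpx. Qed.
Let W20 x y : 0 <= W2 x y. Proof. by case: (HW2 x). Qed.
Let pu0 x y u : 0 <= pu x y u. Proof. by case: (Hpu x y). Qed.
Let W30 x x2 y z : 0 <= W3 x x2 y z. Proof. by case: (HW3 x x2 y). Qed.

Lemma jointP_gt0 t : 0 < P t ->
  [/\ 0 < px t.1.1.1, 0 < gW2 t /\ 0 < gY t, 0 < gpu t /\ 0 < gU t &
      0 < gXUZ t /\ 0 < gZ t].
Proof.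
case: t => -[[x y] u] z; rewrite /P /jointP /gW2 /gY /gpu /gU /gXUZ /gZ /=.
rewrite lt_def !mulf_eq0 !negb_or -!andbA => /and5P[pxn Wn pun W3n _].
have pxp : 0 < px x by rewrite lt_def pxn px0.
have Wp : 0 < W2 x y by rewrite lt_def Wn W20.
have pup : 0 < pu x y u by rewrite lt_def pun pu0.
have W3p : 0 < W3 x (f u x y) y z by rewrite lt_def W3n W30.
have Zp : 0 < auxZ W2 pu W3 f x u z.
  by apply: (@sum_gt0_ge _ _ _ y) => [y'|]; rewrite ?mulr_ge0 ?mulr_gt0.
split => //; split => //.
- by apply: (@sum_gt0_ge _ _ _ x) => [x'|]; rewrite ?mulr_ge0 ?mulr_gt0.
- by apply: (@sum_gt0_ge _ _ _ y) => [y'|]; rewrite ?mulr_ge0 ?mulr_gt0.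
- have Z0 := auxZ_ge0 f HW2 Hpu HW3.
  apply: (@sum_gt0_ge _ _ _ x) => [x'|].
    by apply: sumr_ge0 => u' _; rewrite mulr_ge0.
  by apply: (@sum_gt0_ge _ _ _ u) => [u'|]; rewrite ?mulr_ge0 ?mulr_gt0.
Qed.

(** Gibbs' inequality against the law in which u is drawn from x alone. The sign is needed when the
    real number [L0] of indices is rounded: [L0 >= 1] gives [L <= 2 * L0]. *)
Lemma info_YU_ge0 : 0 <= info_YU.
Proof.
have P0 t : 0 <= P t by case: (jointP_pmf f Hpx HW2 Hpu HW3).
pose q (t : X * Y * U * Z) := px t.1.1.1 * W2 t.1.1.1 t.1.1.2 * gU t *
   W3 t.1.1.1 (f t.1.2 t.1.1.1 t.1.1.2) t.1.1.2 t.2.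
have gU0 t : 0 <= gU t by apply: auxU_ge0.
have q0 t : 0 <= q t by rewrite !mulr_ge0.
have Pq t : 0 < P t -> 0 < q t.
  move=> Pt; have [_ [? _] [_ ?] _] := jointP_gt0 Pt.
  rewrite lt_def q0 andbT !mulf_neq0 ?gt_eqF //; first by case: (jointP_gt0 Pt).
  rewrite lt_def W30 andbT; apply/negP => /eqP W3z.
  by move: Pt; rewrite /P /jointP W3z mulr0 ltxx.
have sq : \sum_t q t = \sum_t P t.
  have [_ ->] := jointP_pmf f Hpx HW2 Hpu HW3.
  have := jointP_pmf (pu := fun x _ u => auxU W2 pu x u) f Hpx HW2 _ HW3.
  case=> // x y; split; last exact: sum_auxU.
  by move=> u; apply: auxU_ge0.
have := gibbs P0 q0 Pq; rewrite sq lexx => /(_ isT).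
rewrite -subr_ge0 -sumrB /info_YU => /le_trans; apply; apply: ler_sum => t _.
have := P0 t; rewrite le_eqVlt => /predU1P[<-|Pt]; first by rewrite !mul0r subrr.
have [pxp [Wp _] [pup Up] _] := jointP_gt0 Pt.
have W3p : 0 < W3 t.1.1.1 (f t.1.2 t.1.1.1 t.1.1.2) t.1.1.2 t.2.
  rewrite lt_def W30 andbT; apply/negP => /eqP W3z.
  by move: Pt; rewrite /P /jointP W3z mulr0 ltxx.
rewrite -mulrBr ler_wpM2l // /P /jointP /q -/(gpu t) !lnM ?posrE ?mulr_gt0 //.
lra.
Qed.

Section Blocks.
Variables (d r : R).
Hypothesis d0 : 0 < d.

Let var (g1 g2 : X * Y * U * Z -> R) :=
  (\sum_t P t * (ln (g1 t) - ln (g2 t) -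
     \sum_t P t * (ln (g1 t) - ln (g2 t))) ^+ 2) / d ^+ 2.

(** The thresholds [a] and [c] lie [d] below their informations, [b] lies [d] above I(Y2;U|X1), and
    the number L of indices has exponent I(Y2;U|X1) + 2d. The terms M/a, b/L and ML/c then decay
    with exponent at least d: the two margins 2d and 4d are what the first and the last of them
    require. The factor 2 in the bound on [M] leaves room for rounding the rate. *)
Lemma coding_bound : r + 2 * d <= info_XY ->
  r + 4 * d <= info_XUZ - info_YU -> X2 ->
  exists K : R, forall n M, (0 < n)%N -> M%:R <= 2 * expR (n%:R * r) ->
  exists c : relay_code X X2 Y Z n M,
    err_prob W2 W3 c <= K * Num.sqrt (n%:R^-1).
Proof.
move=> rd1 rd2 x20.
pose K1 := var gW2 gY; pose K2 := var gU gpu; pose K3 := var gXUZ (fun t => gU t * gZ t).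
exists (K1 + 2 / d + (2 * (K2 + K3) + 2 / d) + 1 + 4 / d) => n M n0 Mle.
have nr : 0 < n%:R :> R by rewrite ltr0n.
have nr1 : 1 <= n%:R :> R by rewrite ler1n.
(* [s] is the level [e] of the one-shot bound: with it, both [e] and the Markov term, of order 1 /
   (n e), are of order n^(-1/2). *)
set s := Num.sqrt _.
have s0 : 0 < s by rewrite sqrtr_gt0 invr_gt0.
have ss : s * s = n%:R^-1 by rewrite -expr2 sqr_sqrtr // invr_ge0 ltW.
have s1 : s <= 1.
  rewrite -[leRHS]sqrtr1 ler_wsqrtr // -[leRHS]invr1 lef_pV2 ?posrE //.
have ns : n%:R^-1 <= s by rewrite -ss -[leRHS]mul1r ler_wpM2r // ltW.
(* Exponentially small terms are weakened to the order of [s], so that a single constant covers all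
   of them. *)
have expd : expR (- (n%:R * d)) <= s / d.
  apply: (@le_trans _ _ (n%:R^-1 / d)); last by rewrite ler_wpM2r // invr_ge0 ltW.
  rewrite expRN -invfM lef_pV2 ?posrE ?expR_gt0 ?mulr_gt0 //.
  by apply: le_trans (expR_ge1Dx _); rewrite lerDr.
have P_pmf := jointP_pmf f Hpx HW2 Hpu HW3.
have P0 t : 0 <= P t by case: P_pmf.
have IU0 := info_YU_ge0.
set a := expR (n%:R * (info_XY - d)).
set b := expR (n%:R * (info_YU + d)).
set c := expR (n%:R * (info_XUZ - d)).
pose L0 := expR (n%:R * (info_YU + 2 * d)); pose L := (Num.truncn L0).+1.
have L01 : 1 <= L0.
  by rewrite -[leLHS]expR0 ler_expR mulr_ge0 ?addr_ge0 ?mulr_ge0 ?(ltW nr) ?(ltW d0).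
have LL : L0 <= L%:R by rewrite ltW // truncnS_gt.
have LL2 : L%:R <= 2 * L0.
  rewrite /L -addn1 natrD; have : (Num.truncn L0)%:R <= L0 by rewrite truncn_le; lra.
  lra.
have Hpxn := is_pmf_prod (fun _ : 'I_n => Hpx).
have HW2n (x : {ffun 'I_n -> X}) := is_pmf_prod (fun i : 'I_n => HW2 (x i)).
have Hpun (x : {ffun 'I_n -> X}) (y : {ffun 'I_n -> Y}) :=
  is_pmf_prod (fun i : 'I_n => Hpu (x i) (y i)).
have HW3n (x : {ffun 'I_n -> X}) (x2 : {ffun 'I_n -> X2}) (y : {ffun 'I_n -> Y}) :=
  is_pmf_prod (fun i : 'I_n => HW3 (x i) (x2 i) (y i)).
have [enc [relay [dec]]] := @one_shot R _ _ _ _ _ (pxn px (n:=n)) (W2n W2 (n:=n))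
  (pun pu (n:=n)) (W3n W3 (n:=n)) (fn f (n:=n)) Hpxn HW2n Hpun HW3n
  [ffun=> x20] M L ord0 a b c s (expR_gt0 _) (expR_gt0 _) (expR_gt0 _) s0.
move=> bnd; exists (RelayCode enc relay dec).
apply: le_trans bnd _; rewrite /one_shot_bound.
have m1 : mean (pxn px (n:=n)) (W2n W2 (n:=n)) (pun pu (n:=n)) (W3n W3 (n:=n)) (fn f (n:=n))
   (fun x y _ _ => (W2n W2 x y <= a * outY (pxn px (n:=n)) (W2n W2 (n:=n)) y)%R%:R) <= K1 * s.
  rewrite meann; apply: (@le_trans _ _ (K1 / n%:R)); last first.
    rewrite ler_wpM2l // /K1 /var divr_ge0 ?sqr_ge0 //.
    by apply: sumr_ge0 => t _; rewrite mulr_ge0 // sqr_ge0.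
  apply: le_trans (@iid_density _ _ P n P_pmf gW2 gY info_XY d n0 d0 _ erefl).
    apply: ler_sum => t _; rewrite ler_wpM2l ?prodr_ge0 // /W2n outYn.
    by rewrite (eq_bigr (fun i => gW2 (t i))) 1?[\prod_i outY _ _ _](eq_bigr (fun i => gY (t i)))
      // => i _; rewrite !ffunE.
  by move=> t /jointP_gt0 [].
have m2 : mean (pxn px (n:=n)) (W2n W2 (n:=n)) (pun pu (n:=n)) (W3n W3 (n:=n)) (fn f (n:=n))
   (fun x y u _ => (b * auxU (W2n W2 (n:=n)) (pun pu (n:=n)) x u < pun pu x y u)%R%:R) <= K2 * s.
  rewrite meann; apply: (@le_trans _ _ (K2 / n%:R)); last first.
    rewrite ler_wpM2l // /K2 /var divr_ge0 ?sqr_ge0 //.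
    by apply: sumr_ge0 => t _; rewrite mulr_ge0 // sqr_ge0.
  (* Here the bad event is a density that is too large, so [iid_density] is applied to the inverse
     ratio. *)
  have mu_neg : \sum_t P t * (ln (gU t) - ln (gpu t)) = - info_YU.
    by rewrite /info_YU -sumrN; apply: eq_bigr => t _; ring.
  apply: le_trans (@iid_density _ _ P n P_pmf gU gpu _ d n0 d0 _ erefl); last first.
    by move=> t /jointP_gt0 [_ _ []].
  rewrite mu_neg.
  apply: ler_sum => t _; rewrite ler_wpM2l ?prodr_ge0 // ler_nat /pun auxUn.
  rewrite (eq_bigr (fun i => gU (t i))) => [|i _]; last by rewrite !ffunE.
  rewrite [X in _ < X](eq_bigr (fun i => gpu (t i))) => [|i _]; last by rewrite !ffunE.
  case: ltP => // lt; rewrite lt0b.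
  rewrite -opprD mulrN expRN -/b mulrC ler_pdivlMr ?expR_gt0 // mulrC; exact: ltW.
have m3 : mean (pxn px (n:=n)) (W2n W2 (n:=n)) (pun pu (n:=n)) (W3n W3 (n:=n)) (fn f (n:=n))
   (fun x _ u z => (auxZ (W2n W2 (n:=n)) (pun pu (n:=n)) (W3n W3 (n:=n)) (fn f (n:=n)) x u z <=
      c * auxU (W2n W2 (n:=n)) (pun pu (n:=n)) x u *
      outZ (pxn px (n:=n)) (W2n W2 (n:=n)) (pun pu (n:=n)) (W3n W3 (n:=n)) (fn f (n:=n)) z)%R%:R)
   <= K3 / n%:R.
  rewrite meann.
  apply: le_trans (@iid_density _ _ P n P_pmf gXUZ (fun t => gU t * gZ t) info_XUZ d n0 d0 _ erefl).
    apply: ler_sum => t _; rewrite ler_wpM2l ?prodr_ge0 // auxZn auxUn outZn big_split /= mulrA.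
    rewrite (eq_bigr (fun i => gXUZ (t i))) => [|i _]; last by rewrite !ffunE.
    rewrite [\prod_i auxU _ _ _ _](eq_bigr (fun i => gU (t i))) => [|i _]; last by rewrite !ffunE.
    by rewrite [\prod_i outZ _ _ _ _ _ _](eq_bigr (fun i => gZ (t i))) => [|i _]; last by rewrite !ffunE.
  by move=> t /jointP_gt0 [_ _ [_ ?] [? ?]]; split => //; apply: mulr_gt0.
have m3' : s^-1 * mean (pxn px (n:=n)) (W2n W2 (n:=n)) (pun pu (n:=n)) (W3n W3 (n:=n)) (fn f (n:=n))
   (fun x _ u z => (auxZ (W2n W2 (n:=n)) (pun pu (n:=n)) (W3n W3 (n:=n)) (fn f (n:=n)) x u z <=
      c * auxU (W2n W2 (n:=n)) (pun pu (n:=n)) x u *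
      outZ (pxn px (n:=n)) (W2n W2 (n:=n)) (pun pu (n:=n)) (W3n W3 (n:=n)) (fn f (n:=n)) z)%R%:R)
   <= K3 * s.
  by rewrite mulrC ler_pdivrMr // -mulrA ss.
have m4 : M%:R * a^-1 <= 2 / d * s.
  apply: (@le_trans _ _ (2 * expR (- (n%:R * d)))); last first.
    by rewrite -mulrA [d^-1 * s]mulrC ler_pM2l.
  rewrite /a -expRN; apply: le_trans (ler_wpM2r (expR_ge0 _) Mle) _.
  rewrite -mulrA -expRD ler_pM2l // ler_expR -mulrN -mulrDr -mulrN ler_wpM2l ?(ltW nr) //; lra.
have m5 : 2 * b / L%:R <= 2 / d * s.
  apply: (@le_trans _ _ (2 * expR (- (n%:R * d)))); last first.
    by rewrite -mulrA [d^-1 * s]mulrC ler_pM2l.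
  rewrite -mulrA ler_pM2l // ler_pdivrMr ?ltr0n //.
  apply: (@le_trans _ _ (expR (- (n%:R * d)) * L0)); last by rewrite ler_wpM2l ?expR_ge0.
  rewrite /b /L0 -expRD ler_expR -mulrN -mulrDr ler_wpM2l ?(ltW nr) //; lra.
have m6 : M%:R * L%:R / c <= 4 / d * s.
  apply: (@le_trans _ _ (4 * expR (- (n%:R * d)))); last first.
    by rewrite -mulrA [d^-1 * s]mulrC ler_pM2l.
  rewrite /c -expRN; apply: (@le_trans _ _ ((2 * expR (n%:R * r)) * (2 * L0) *
     expR (- (n%:R * (info_XUZ - d))))).
    by rewrite ler_wpM2r ?expR_ge0 // ler_pM.
  have -> : 2 * expR (n%:R * r) * (2 * L0) * expR (- (n%:R * (info_XUZ - d))) =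
    4 * (expR (n%:R * r) * L0 * expR (- (n%:R * (info_XUZ - d)))) by ring.
  rewrite /L0 -!expRD ler_pM2l // ler_expR -!mulrN -!mulrDr ler_wpM2l ?(ltW nr) //; lra.
rewrite !mulrDl -!mulrDr; move: m1 m2 m3' m4 m5 m6; lra.
Qed.

End Blocks.
End Achievability.

(** * Achievability *)

Lemma sum_delta (R : realType) (T : finType) (F : T -> R) (a : T) :
  \sum_t F t * (t == a)%:R = F a.
Proof.
rewrite (bigD1 a) //= eqxx mulr1 big1 ?addr0 // => t /negbTE ->.
by rewrite mulr0.
Qed.

Lemma sum_delta2 (R : realType) (T S : finType) (F : T -> S -> R) (a : T) (b : S) :
  \sum_t \sum_s F t s * ((t == a) && (s == b))%:R = F a b.
Proof.
rewrite pair_bigA /= -(sum_delta (fun p => F p.1 p.2) (a, b)).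
by apply: eq_bigr => -[t s] _; rewrite xpair_eqE.
Qed.

Lemma sum_delta3 (R : realType) (T S Q : finType) (F : T -> S -> Q -> R) a b c :
  \sum_t \sum_s \sum_q F t s q * [&& t == a, s == b & q == c]%:R = F a b c.
Proof.
rewrite -[RHS](sum_delta2 (fun t s => F t s c) a b).
apply: eq_bigr => t _; apply: eq_bigr => s _.
under eq_bigr => q _ do rewrite andbA -mulnb natrM mulrCA mulrC.
by rewrite -mulr_suml sum_delta.
Qed.

Section RelayValue.
Variables (R : realType) (X1 X2 Y2 Y3 : finType) (k : nat).
Variables (W2 : X1 -> Y2 -> R) (W3 : X1 -> X2 -> Y2 -> Y3 -> R).
Variables (px : X1 -> R) (pu : X1 -> Y2 -> 'I_k -> R) (f : 'I_k -> X1 -> Y2 -> X2).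
Hypothesis HW2 : forall x, is_pmf (W2 x).
Hypothesis HW3 : forall x x2 y, is_pmf (W3 x x2 y).
Hypothesis Hpx : is_pmf px.
Hypothesis Hpu : forall x y, is_pmf (pu x y).

Let P := relay_joint W2 W3 px pu f.
Let vx1 := fun t : X1 * Y2 * 'I_k * Y3 => t.1.1.1.
Let vy2 := fun t : X1 * Y2 * 'I_k * Y3 => t.1.1.2.
Let vu  := fun t : X1 * Y2 * 'I_k * Y3 => t.1.2.
Let vy3 := fun t : X1 * Y2 * 'I_k * Y3 => t.2.
Let oY := outY px W2.
Let aU := auxU W2 pu.
Let aZ := auxZ W2 pu W3 f.
Let oZ := outZ px W2 pu W3 f.

Lemma relay_jointE t : P t = jointP px W2 pu W3 f t.
Proof. by case: t => -[[x y] u] z. Qed.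

Let probE (E : X1 -> Y2 -> 'I_k -> Y3 -> bool) :
  prob P (fun t => E (vx1 t) (vy2 t) (vu t) (vy3 t)) =
  mean px W2 pu W3 f (fun x y u z => (E x y u z)%:R).
Proof.
rewrite -sum_jointP /prob big_mkcond; apply: eq_bigr => t _.
by rewrite -relay_jointE; case: ifP; rewrite /= ?mulr1 ?mulr0 // => ->; rewrite ?mulr1 ?mulr0.
Qed.

Let prob_xy x y : prob P [pred s | (vx1 s == x) && (vy2 s == y)] = px x * W2 x y.
Proof.
rewrite (probE (fun x' y' _ _ => (x' == x) && (y' == y))).
rewrite (mean_xy px W2 f Hpu HW3 (fun x' y' => ((x' == x) && (y' == y))%:R)).
exact: sum_delta2.
Qed.

Let prob_x x : prob P [pred s | vx1 s == x] = px x.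
Proof.
rewrite (probE (fun x' _ _ _ => x' == x)).
rewrite (mean_xy px W2 f Hpu HW3 (fun x' _ => (x' == x)%:R)) -[RHS](sum_delta px x).
apply: eq_bigr => x' _; rewrite -mulr_suml -mulr_sumr.
by case: (HW2 x') => _ ->; rewrite mulr1.
Qed.

Let prob_y y : prob P [pred s | vy2 s == y] = oY y.
Proof.
rewrite (probE (fun _ y' _ _ => y' == y)).
rewrite (mean_xy px W2 f Hpu HW3 (fun _ y' => (y' == y)%:R)) exchange_big -[RHS](sum_delta oY y).
by apply: eq_bigr => y' _; rewrite -mulr_suml.
Qed.

Let prob_yux y u x :
  prob P [pred s | [&& vy2 s == y, vu s == u & vx1 s == x]] = px x * W2 x y * pu x y u.
Proof.
rewrite (probE (fun x' y' u' _ => [&& y' == y, u' == u & x' == x])).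
rewrite (mean_xyu px W2 pu f HW3 (fun x' y' u' => [&& y' == y, u' == u & x' == x]%:R)).
rewrite -[RHS](sum_delta3 (fun x y u => px x * W2 x y * pu x y u) x y u).
do 3 (apply: eq_bigr => ? _); congr (_ * _%:R); case: (_ == y); case: (_ == u); case: (_ == x) => //.
Qed.

Let prob_yx y x : prob P [pred s | (vy2 s == y) && (vx1 s == x)] = px x * W2 x y.
Proof. by rewrite -prob_xy; apply: eq_bigl => s /=; rewrite andbC. Qed.

Let mean_xu (g : X1 -> 'I_k -> R) :
  mean px W2 pu W3 f (fun x _ u _ => g x u) = \sum_x \sum_u px x * aU x u * g x u.
Proof.
rewrite (mean_xyu px W2 pu f HW3 (fun x _ u => g x u)); apply: eq_bigr => x _.
rewrite exchange_big; apply: eq_bigr => u _; rewrite /aU /auxU mulr_sumr mulr_suml.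
by apply: eq_bigr => y _; rewrite !mulrA.
Qed.

Let prob_ux u x : prob P [pred s | (vu s == u) && (vx1 s == x)] = px x * aU x u.
Proof.
rewrite (probE (fun x' _ u' _ => (u' == u) && (x' == x))).
rewrite (mean_xu (fun x' u' => ((u' == u) && (x' == x))%:R)).
rewrite -[RHS](sum_delta2 (fun x u => px x * aU x u) x u).
by do 2 (apply: eq_bigr => ? _); rewrite andbC.
Qed.

Let prob_xu x u : prob P [pred s | (vx1 s, vu s) == (x, u)] = px x * aU x u.
Proof. by rewrite -prob_ux; apply: eq_bigl => s /=; rewrite xpair_eqE andbC. Qed.

Let prob_z z : prob P [pred s | vy3 s == z] = oZ z.
Proof.
rewrite (probE (fun _ _ _ z' => z' == z)).
rewrite (mean_xuz px W2 pu W3 f (fun _ _ z' => (z' == z)%:R)) -[RHS](sum_delta oZ z).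
under eq_bigr => x' _ do rewrite exchange_big.
rewrite exchange_big; apply: eq_bigr => z' _ /=; rewrite /oZ /outZ mulr_suml.
by apply: eq_bigr => x' _; rewrite mulr_suml.
Qed.

Let prob_xuz x u z :
  prob P [pred s | ((vx1 s, vu s) == (x, u)) && (vy3 s == z)] = px x * aZ x u z.
Proof.
rewrite (probE (fun x' _ u' z' => ((x', u') == (x, u)) && (z' == z))).
rewrite (mean_xuz px W2 pu W3 f (fun x' u' z' => (((x', u') == (x, u)) && (z' == z))%:R)).
rewrite -[RHS](sum_delta3 (fun x u z => px x * aZ x u z) x u z).
by do 3 (apply: eq_bigr => ? _); rewrite xpair_eqE andbA.
Qed.

Let ge0P t : 0 <= P t.
Proof. by rewrite relay_jointE; case: (jointP_pmf f Hpx HW2 Hpu HW3). Qed.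

Let sum_log2 (g h : X1 * Y2 * 'I_k * Y3 -> R) :
  (forall t, 0 < P t -> ln (g t) = h t) ->
  \sum_t P t * log2 (g t) = (\sum_t jointP px W2 pu W3 f t * h t) / ln 2.
Proof.
move=> gh; rewrite mulr_suml; apply: eq_bigr => t _; rewrite -relay_jointE.
have := ge0P t; rewrite le_eqVlt => /predU1P[<-|Pt]; first by rewrite !mul0r.
by rewrite /log2 gh // mulrA.
Qed.

Lemma relay_valueE : relay_value W2 W3 px pu f =
  Num.min (info_XY px W2 pu W3 f)
          (info_XUZ px W2 pu W3 f - info_YU px W2 pu W3 f) / ln 2.
Proof.
have l2 : 0 < ln (2 : R) by rewrite ln_gt0 // ltr1n.
rewrite minr_pMl ?invr_ge0 ?ltW // mulrBl.
rewrite /relay_value -/P -/vx1 -/vy2 -/vu -/vy3; congr (Num.min _ (_ - _)).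
- apply: sum_log2 => t; rewrite relay_jointE => /(jointP_gt0 Hpx HW2 Hpu HW3)[pxp [Wp Yp] _ _].
  rewrite prob_xy prob_x prob_y -mulf_div divff ?gt_eqF // mul1r ln_div //.
- apply: sum_log2 => t; rewrite relay_jointE => /(jointP_gt0 Hpx HW2 Hpu HW3)[pxp _ [_ Up] [XUZp Zp]].
  rewrite prob_xuz prob_xu prob_z -[X in _ / X]mulrA -mulf_div divff ?gt_eqF // mul1r ln_div ?posrE ?mulr_gt0 //.
- apply: sum_log2 => t; rewrite relay_jointE => /(jointP_gt0 Hpx HW2 Hpu HW3)[pxp [Wp _] [pup Up] _].
  rewrite prob_yux prob_x prob_yx prob_ux -ln_div ?posrE //; congr ln.
  by rewrite /vx1 /vy2 /vu /aU; field; rewrite !gt_eqF.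
Qed.

End RelayValue.

Section NumMsgs.
Variable R : realType.

Lemma num_msgsE (n : nat) (r : R) : 0 <= r ->
  (num_msgs n r)%:R = expR ((Num.ceil (n%:R * r))%:~R * ln 2) :> R.
Proof.
move=> r0; have c0 : 0 <= Num.ceil (n%:R * r).
  by rewrite ceil_ge0 // (lt_le_trans _ (mulr_ge0 _ r0)) // ltrN10.
rewrite /num_msgs natrX -[X in X ^+ _](@lnK R 2) ?posrE // -expRM_natl.
by rewrite natr_absz ger0_norm.
Qed.

(** The ceiling adds less than one bit, hence a factor 2 on the number of messages. *)
Lemma num_msgs_le (n : nat) (r : R) : 0 <= r ->
  (num_msgs n r)%:R <= 2 * expR (n%:R * (r * ln 2)) :> R.
Proof.
move=> r0; rewrite num_msgsE // -[X in _ <= X * _](@lnK R 2) ?posrE // -expRD ler_expR.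
have l2 : 0 < ln (2 : R) by rewrite ln_gt0 // ltr1n.
have : (Num.ceil (n%:R * r))%:~R <= n%:R * r + 1 :> R.
  by rewrite -lerBlDr -[X in _ - X]/(1%:~R) -intrB ltW // ceilB1_lt.
by rewrite -(ler_pM2r l2); lra.
Qed.

End NumMsgs.

Lemma cvg_sqrt_inv (R : realType) (K : R) (u : nat -> R) :
  (forall n, 0 <= u n) ->
  (forall n, (0 < n)%N -> u n <= K * Num.sqrt (n%:R^-1)) -> (u @ \oo --> (0 : R))%classic.
Proof.
move=> u0 uK; apply/cvgrPdist_lt => e e0.
pose k := `|K| + 1; have k0 : 0 < k by rewrite ltr_wpDl.
near=> n; have n0 : (0 < n)%N by near: n; exists 1%N.
have nr : 0 < n%:R :> R by rewrite ltr0n.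
rewrite sub0r normrN ger0_norm //; apply: le_lt_trans (uK _ n0) _.
have s0 : 0 < Num.sqrt (n%:R^-1) :> R by rewrite sqrtr_gt0 invr_gt0.
apply: (@lt_trans _ _ (k * Num.sqrt (n%:R^-1))).
  by rewrite ltr_pM2r // (le_lt_trans (ler_norm K)) // ltrDl.
rewrite mulrC -ltr_pdivlMr // -[ltRHS]ger0_norm ?divr_ge0 ?ltW // -sqrtr_sqr ltr_sqrt; last first.
  by rewrite exprn_gt0 // divr_gt0.
rewrite -[ltRHS]invrK ltf_pV2 ?posrE ?invr_gt0 ?exprn_gt0 ?divr_gt0 //.
by near: n; apply: nbhs_infty_gtr.
Unshelve. all: by end_near.
Qed.

Section Achievable.
Variables (R : realType) (X1 X2 Y2 Y3 : finType).
Variables (W2 : X1 -> Y2 -> R) (W3 : X1 -> X2 -> Y2 -> Y3 -> R).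
Hypothesis HW2 : forall x, is_pmf (W2 x).
Hypothesis HW3 : forall x x2 y, is_pmf (W3 x x2 y).

Lemma err_prob_ge0 n M (c : relay_code X1 X2 Y2 Y3 n M) : 0 <= err_prob W2 W3 c.
Proof.
have W20 x y : 0 <= W2 x y by case: (HW2 x).
have W30 x x2 y z : 0 <= W3 x x2 y z by case: (HW3 x x2 y).
rewrite /err_prob mulr_ge0 ?invr_ge0 //; do 3 (apply: sumr_ge0 => ? _).
by rewrite mulr_ge0 // prodr_ge0.
Qed.

Lemma relay_value_achievable (x10 : X1) (x20 : X2) (k : nat)
  (px : X1 -> R) (pu : X1 -> Y2 -> 'I_k -> R) (f : 'I_k -> X1 -> Y2 -> X2) (r : R) :
  is_pmf px -> (forall x y, is_pmf (pu x y)) ->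
  0 <= r -> r < relay_value W2 W3 px pu f -> achievable W2 W3 r.
Proof.
move=> Hpx Hpu r0; rewrite relay_valueE //.
have l2 : 0 < ln (2 : R) by rewrite ln_gt0 // ltr1n.
rewrite ltr_pdivlMr // lt_min => /andP[lt1 lt2].
set IXY := info_XY _ _ _ _ _ in lt1; set I2 := _ - _ in lt2.
(* A quarter of the smaller slack serves both margins, 2d and 4d, of [coding_bound]. *)
pose d := Num.min (IXY - r * ln 2) (I2 - r * ln 2) / 4.
have d0 : 0 < d by rewrite divr_gt0 // lt_min !subr_gt0 lt1.
have d1 : d <= (IXY - r * ln 2) / 4 by rewrite ler_pM2r // ge_min lexx.
have d2 : d <= (I2 - r * ln 2) / 4 by rewrite ler_pM2r // ge_min lexx orbT.
have := @coding_bound R X1 Y2 'I_k X2 Y3 px W2 pu W3 f Hpx HW2 Hpu HW3 d (r * ln 2) d0.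
case=> [||//|K HK]; [rewrite -/IXY; lra|rewrite -/I2; lra|].
split=> //.
have code n : exists c : relay_code X1 X2 Y2 Y3 n (num_msgs n r),
    (0 < n)%N -> err_prob W2 W3 c <= K * Num.sqrt (n%:R^-1).
  have [->|n0] := posnP n.
    by exists (RelayCode (fun=> [ffun=> x10]) (fun=> [ffun=> x20]) (fun=> None)).
  have [c Hc] := HK n (num_msgs n r) n0 (num_msgs_le n r0).
  by exists c.
exists (fun n => projT1 (cid (code n))).
apply: (@cvg_sqrt_inv R K) => n; first exact: err_prob_ge0.
by move=> n0; case: (cid (code n)) => c /= ->.
Qed.

End Achievable.

(** * Entropy forms of the two rates *)

Section EntropyGap.
Variable R : realType.

(* The gap is H(Y|Z) - H(Z|Y) for the (unnormalized) law [p v y * K y z]; it is homogeneous of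
   degree one and concave in [p]. *)
Lemma entropy_gap_superadd (V Y Z : finType) (p : V -> Y -> R) (K : Y -> Z -> R) :
  (forall v y, 0 <= p v y) -> (forall y, is_pmf (K y)) ->
  \sum_v (\sum_y nxlnx (p v y) - \sum_z nxlnx (\sum_y p v y * K y z)) <=
  \sum_y nxlnx (\sum_v p v y) - \sum_z nxlnx (\sum_v \sum_y p v y * K y z).
Proof.
move=> p0 HK.
have K0 y z : 0 <= K y z by case: (HK y).
have K1 y : \sum_z K y z = 1 by case: (HK y).
pose r v z := \sum_y p v y * K y z; pose P y := \sum_v p v y; pose Q z := \sum_v r v z.
have r0 v z : 0 <= r v z by apply: sumr_ge0 => y _; rewrite mulr_ge0.
have P0 y : 0 <= P y by apply: sumr_ge0.
have Q0 z : 0 <= Q z by apply: sumr_ge0.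
pose j v y z := p v y * K y z.
have -> : \sum_y nxlnx (\sum_v p v y) - \sum_z nxlnx (\sum_v \sum_y p v y * K y z) =
   \sum_v \sum_y \sum_z j v y z * (ln (Q z) - ln (P y)).
  transitivity (\sum_v \sum_y \sum_z j v y z * ln (Q z) -
      \sum_v \sum_y \sum_z j v y z * ln (P y)).
    rewrite addrC; congr (_ + _).
      rewrite -sumrN [RHS](eq_bigr (fun v => \sum_z r v z * ln (Q z))) => [|v _].
        rewrite exchange_big; apply: eq_bigr => z _ /=.
        by rewrite /nxlnx opprK -mulr_suml.
      by rewrite exchange_big; apply: eq_bigr => z _; rewrite -mulr_suml.
    rewrite exchange_big -sumrN; apply: eq_bigr => y _ /=.
    rewrite /nxlnx -/(P y) {1}/P mulr_suml; congr (- _); apply: eq_bigr => v _.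
    by rewrite -mulr_suml -mulr_sumr K1 mulr1.
  rewrite -sumrB; apply: eq_bigr => v _; rewrite -sumrB; apply: eq_bigr => y _.
  by rewrite -sumrB; apply: eq_bigr => z _; rewrite mulrBr.
have -> : \sum_v (\sum_y nxlnx (p v y) - \sum_z nxlnx (\sum_y p v y * K y z)) =
   \sum_v \sum_y \sum_z j v y z * (ln (r v z) - ln (p v y)).
  apply: eq_bigr => v _.
  transitivity (\sum_y \sum_z j v y z * ln (r v z) - \sum_y \sum_z j v y z * ln (p v y)).
    rewrite addrC; congr (_ + _).
      rewrite -sumrN exchange_big; apply: eq_bigr => z _ /=.
      by rewrite /nxlnx opprK -mulr_suml.
    rewrite -sumrN; apply: eq_bigr => y _ /=.
    by rewrite -mulr_suml -mulr_sumr K1 mulr1.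
  rewrite -sumrB; apply: eq_bigr => y _.
  by rewrite -sumrB; apply: eq_bigr => z _; rewrite mulrBr.
(* In [q], v and y are conditionally independent given z, with the same (y, z) and (v, z) marginals
   as in [j]. The difference of the two sides is the divergence of [j] from [q], an unnormalized
   I(V;Y|Z). *)
pose q v y z := K y z * P y * r v z / Q z.
have q0 v y z : 0 <= q v y z by rewrite !mulr_ge0 ?invr_ge0.
have j0 v y z : 0 <= j v y z by rewrite mulr_ge0.
rewrite -subr_le0 -sumrB.
apply: (@le_trans _ _ (\sum_v \sum_y \sum_z (q v y z - j v y z))).
  apply: ler_sum => v _; rewrite -sumrB; apply: ler_sum => y _.
  rewrite -sumrB; apply: ler_sum => z _; rewrite -mulrBr.
  have := j0 v y z; rewrite le_eqVlt => /predU1P[<-|jp]; first by rewrite mul0r subr0.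
  have [pp Kp] : 0 < p v y /\ 0 < K y z.
    by move: jp; rewrite lt_def mulf_eq0 negb_or -andbA => /and3P[pn Kn _]; rewrite !lt_def pn Kn p0 K0.
  have rp : 0 < r v z by apply: (@sum_gt0_ge _ _ _ y) => // y'; apply: j0.
  have Pp : 0 < P y by apply: (@sum_gt0_ge _ _ _ v).
  have Qp : 0 < Q z by apply: (@sum_gt0_ge _ _ _ v).
  have qp : 0 < q v y z by rewrite /q !mulr_gt0 // invr_gt0.
  apply: le_trans (ln_ratio_le (j0 v y z) (q0 v y z) (fun=> qp)).
  rewrite ler_wpM2l // /q /j ln_div ?posrE ?mulr_gt0 // !lnM ?posrE ?mulr_gt0 //; lra.
have -> : \sum_v \sum_y \sum_z (q v y z - j v y z) =
  \sum_y \sum_z (\sum_v q v y z - K y z * P y).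
  rewrite exchange_big; apply: eq_bigr => y _ /=; rewrite exchange_big.
  apply: eq_bigr => z _ /=; rewrite sumrB; congr (_ - _).
  by rewrite /P mulr_sumr; apply: eq_bigr => v _; rewrite mulrC.
apply: sumr_le0 => y _; apply: sumr_le0 => z _; rewrite subr_le0.
rewrite /q -mulr_suml -mulr_sumr -/(Q z) -mulrA -[leRHS]mulr1.
rewrite ler_wpM2l ?mulr_ge0 //.
by have [->|Qn] := eqVneq (Q z) 0; rewrite ?mul0r // divff.
Qed.

End EntropyGap.

Section EtaForms.
Variables (R : realType) (X Y U X2 Z : finType).
Variables (px : X -> R) (W2 : X -> Y -> R) (pu : X -> Y -> U -> R).
Variables (W3 : X -> X2 -> Y -> Z -> R) (f : U -> X -> Y -> X2).

Definition relay_rate := \sum_y nxlnx (outY px W2 y) - \sum_x px x * \sum_y nxlnx (W2 x y).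
(** H(Y3) - H(U,Y3|X1) + H(U|X1,Y2): the two occurrences of H(U|X1) in I(X1,U;Y3) - I(Y2;U|X1) have
    cancelled, which leaves no quotient of probabilities. *)
Definition receiver_rate := \sum_z nxlnx (outZ px W2 pu W3 f z)
  - \sum_x px x * (\sum_u \sum_z nxlnx (auxZ W2 pu W3 f x u z))
  + \sum_x px x * (\sum_y W2 x y * \sum_u nxlnx (pu x y u)).

Hypothesis Hpx : is_pmf px.
Hypothesis HW2 : forall x, is_pmf (W2 x).
Hypothesis Hpu : forall x y, is_pmf (pu x y).
Hypothesis HW3 : forall x x2 y, is_pmf (W3 x x2 y).

Let px0 x : 0 <= px x. Proof. by case: Hpx. Qed.
Let W20 x y : 0 <= W2 x y. Proof. by case: (HW2 x). Qed.
Let pu0 x y u : 0 <= pu x y u. Proof. by case: (Hpu x y). Qed.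
Let W21 x : \sum_y W2 x y = 1. Proof. by case: (HW2 x). Qed.
Let pu1 x y : \sum_u pu x y u = 1. Proof. by case: (Hpu x y). Qed.
Let W31 x x2 y : \sum_z W3 x x2 y z = 1. Proof. by case: (HW3 x x2 y). Qed.

Lemma info_XYE : info_XY px W2 pu W3 f = relay_rate.
Proof.
rewrite /info_XY (sum_jointP _ _ _ _ _ (fun x y _ _ => ln (W2 x y) - ln (outY px W2 y))).
rewrite (mean_xy px W2 f Hpu HW3 (fun x y => ln (W2 x y) - ln (outY px W2 y))).
rewrite /relay_rate addrC -sumrN.
under eq_bigr => x _ do under eq_bigr => y _ do rewrite mulrBr.
under eq_bigr => x _ do rewrite sumrB.
rewrite sumrB; congr (_ + _).
  apply: eq_bigr => x _; rewrite -mulrN -sumrN mulr_sumr; apply: eq_bigr => y _.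
  by rewrite /nxlnx opprK mulrA.
rewrite exchange_big -sumrN; apply: eq_bigr => y _ /=.
by rewrite /nxlnx -mulr_suml.
Qed.

Lemma info_XUZ_subE : info_XUZ px W2 pu W3 f - info_YU px W2 pu W3 f = receiver_rate.
Proof.
have P0 t : 0 <= jointP px W2 pu W3 f t by case: (jointP_pmf f Hpx HW2 Hpu HW3).
transitivity (\sum_t jointP px W2 pu W3 f t * (
   (ln (auxZ W2 pu W3 f t.1.1.1 t.1.2 t.2) - ln (outZ px W2 pu W3 f t.2))
   - ln (pu t.1.1.1 t.1.1.2 t.1.2))).
  rewrite /info_XUZ /info_YU -sumrB; apply: eq_bigr => t _; rewrite -mulrBr.
  have := P0 t; rewrite le_eqVlt => /predU1P[<-|Pt]; first by rewrite !mul0r.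
  have [_ _ [_ Up] [_ Zp]] := jointP_gt0 Hpx HW2 Hpu HW3 Pt.
  rewrite lnM //; ring.
under eq_bigr => t _ do rewrite mulrBr.
rewrite sumrB (sum_jointP _ _ _ _ _ (fun x y u z => ln (auxZ W2 pu W3 f x u z) - ln (outZ px W2 pu W3 f z))).
rewrite (sum_jointP _ _ _ _ _ (fun x y u z => ln (pu x y u))).
rewrite (mean_xuz px W2 pu W3 f (fun x u z => ln (auxZ W2 pu W3 f x u z) - ln (outZ px W2 pu W3 f z))).
rewrite (mean_xyu px W2 pu f HW3 (fun x y u => ln (pu x y u))) /receiver_rate; congr (_ + _).
  rewrite [RHS]addrC -sumrN.
  under eq_bigr => x _ do under eq_bigr => u _ do under eq_bigr => z _ do rewrite mulrBr.
  under eq_bigr => x _ do under eq_bigr => u _ do rewrite sumrB.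
  under eq_bigr => x _ do rewrite sumrB.
  rewrite sumrB; congr (_ + _).
    apply: eq_bigr => x _; rewrite -mulrN -sumrN mulr_sumr; apply: eq_bigr => u _.
    by rewrite -sumrN mulr_sumr; apply: eq_bigr => z _; rewrite /nxlnx opprK mulrA.
  under eq_bigr => x _ do rewrite exchange_big.
  rewrite exchange_big -sumrN; apply: eq_bigr => z _ /=.
  rewrite /nxlnx /outZ mulr_suml; congr (- _); apply: eq_bigr => x _.
  by rewrite mulr_suml.
rewrite -sumrN; apply: eq_bigr => x _; rewrite mulr_sumr -sumrN.
apply: eq_bigr => y _; rewrite mulrA mulr_sumr -sumrN; apply: eq_bigr => u _.
by rewrite /nxlnx mulrN mulrA.
Qed.

Lemma sum_auxZ x : \sum_u \sum_z auxZ W2 pu W3 f x u z = 1.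
Proof.
rewrite -(sum_auxU HW2 Hpu x); apply: eq_bigr => u _.
by rewrite exchange_big; apply: eq_bigr => y _; rewrite -mulr_sumr W31 mulr1.
Qed.

(** In joint weights the rate is H(Y3) + H(X1,U,Y2) - H(X1,U,Y3) - H(Y2|X1). The middle difference
    is a sum of entropy gaps, one for each (x, u), and so is open to superadditivity. *)
Lemma receiver_rate_jointE (q : X -> Y -> U -> R) :
  (forall x y u, q x y u = px x * W2 x y * pu x y u) ->
  receiver_rate = \sum_z nxlnx (\sum_x \sum_u \sum_y q x y u * W3 x (f u x y) y z)
   + \sum_x \sum_u (\sum_y nxlnx (q x y u) -
       \sum_z nxlnx (\sum_y q x y u * W3 x (f u x y) y z))
   - \sum_x px x * \sum_y nxlnx (W2 x y).
Proof.
move=> qE.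
have RE x u z : \sum_y q x y u * W3 x (f u x y) y z = px x * auxZ W2 pu W3 f x u z.
  by rewrite mulr_sumr; apply: eq_bigr => y _; rewrite qE !mulrA.
have Z0 := auxZ_ge0 f HW2 Hpu HW3.
have -> : \sum_z nxlnx (\sum_x \sum_u \sum_y q x y u * W3 x (f u x y) y z) =
    \sum_z nxlnx (outZ px W2 pu W3 f z).
  by apply: eq_bigr => z _; congr nxlnx; do 2 (apply: eq_bigr => ? _); rewrite RE.
rewrite /receiver_rate -!addrA; congr (_ + _).
rewrite -!sumrN -!big_split /=.
apply: eq_bigr => x _; rewrite sumrB.
have -> : \sum_u \sum_z nxlnx (\sum_y q x y u * W3 x (f u x y) y z) =
  px x * (\sum_u \sum_z nxlnx (auxZ W2 pu W3 f x u z)) + nxlnx (px x).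
  rewrite -[X in _ + X]mul1r -(sum_auxZ x) mulr_suml mulr_sumr -big_split /=.
  apply: eq_bigr => u _; rewrite mulr_suml mulr_sumr -big_split /=.
  by apply: eq_bigr => z _; rewrite RE nxlnxM.
have -> : \sum_u \sum_y nxlnx (q x y u) =
  px x * (\sum_y W2 x y * \sum_u nxlnx (pu x y u)) + (px x * \sum_y nxlnx (W2 x y) + nxlnx (px x)).
  rewrite -[nxlnx (px x)]mul1r -(W21 x) mulr_suml !mulr_sumr -!big_split /=.
  rewrite exchange_big; apply: eq_bigr => y _ /=.
  rewrite -nxlnxM // -[X in _ + X]mul1r -(pu1 x y) mulr_suml !mulr_sumr -big_split /=.
  by apply: eq_bigr => u _; rewrite qE nxlnxM ?mulr_ge0 // !mulrA.
ring.
Qed.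

End EtaForms.

(** * Strategies as auxiliary variable *)

Section Strategies.
Variables (R : realType) (X Y X2 Z V : finType).
Variables (px : X -> R) (W2 : X -> Y -> R) (W3 : X -> X2 -> Y -> Z -> R).
Variables (l : V -> X) (b : V -> Y -> X2 -> R) (x20 : X2).
Hypothesis Hpx : is_pmf px.
Hypothesis HW2 : forall x, is_pmf (W2 x).
Hypothesis HW3 : forall x x2 y, is_pmf (W3 x x2 y).
Hypothesis b0 : forall v y x2, 0 <= b v y x2.
Hypothesis bW2 : forall x y, \sum_(v | l v == x) \sum_x2 b v y x2 = px x * W2 x y.

Definition strategy (s : {ffun Y -> X2}) (x : X) (y : Y) : X2 := s y.

Let S : finType := {ffun Y -> X2}.
(* [c v] draws the strategy coordinates independently from the conditional laws [kap v y] of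
   [x2], so that the strategy is independent of [y] given [v]. *)
Let a v y := \sum_x2 b v y x2.
Let kap v y x2 : R := if a v y == 0 then (x2 == x20)%:R else b v y x2 / a v y.
Let c v (s : S) := \prod_y kap v y (s y).
Let r v z := \sum_y \sum_x2 b v y x2 * W3 (l v) x2 y z.
Let rs v (s : S) z := \sum_y a v y * W3 (l v) (s y) y z.
Let q x y (s : S) := \sum_(v | l v == x) a v y * c v s.
Let pu x y (s : S) : R :=
  if px x * W2 x y == 0 then (s == [ffun=> x20])%:R else q x y s / (px x * W2 x y).

Let px0 x : 0 <= px x. Proof. by case: Hpx. Qed.
Let W20 x y : 0 <= W2 x y. Proof. by case: (HW2 x). Qed.
Let W30 x x2 y z : 0 <= W3 x x2 y z. Proof. by case: (HW3 x x2 y). Qed.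
Let W31 x x2 y : \sum_z W3 x x2 y z = 1. Proof. by case: (HW3 x x2 y). Qed.
Let a0 v y : 0 <= a v y. Proof. exact: sumr_ge0. Qed.
Let kap0 v y x2 : 0 <= kap v y x2.
Proof. by rewrite /kap; case: ifP => // _; rewrite divr_ge0. Qed.
Let kap1 v y : \sum_x2 kap v y x2 = 1.
Proof.
rewrite /kap; case: eqVneq => [_|an].
  by rewrite -[RHS](sum_delta (fun=> 1) x20); apply: eq_bigr => x2 _; rewrite mul1r.
by rewrite -mulr_suml divff.
Qed.
Let akap v y x2 : a v y * kap v y x2 = b v y x2.
Proof.
rewrite /kap; case: eqVneq => [av|an]; last by rewrite mulrC divfK.
by rewrite av mul0r (sum_eq0_ge0 _ av).
Qed.
Let c0 v s : 0 <= c v s. Proof. exact: prodr_ge0. Qed.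
Let c1 v : \sum_s c v s = 1.
Proof. by rewrite (sum_ffun_prod (kap v)) big1. Qed.
Let rs0 v s z : 0 <= rs v s z.
Proof. by apply: sumr_ge0 => y _; rewrite mulr_ge0. Qed.
Let q0 x y s : 0 <= q x y s.
Proof. by apply: sumr_ge0 => v _; rewrite mulr_ge0. Qed.

(** At a given y only the coordinate [s y] enters, so averaging over product strategies restores the
    conditional law of x2, and with it the law of z. *)
Let sum_c_rs v z : \sum_s c v s * rs v s z = r v z.
Proof.
under eq_bigr => s _ do rewrite mulr_sumr.
rewrite exchange_big; apply: eq_bigr => y _ /=.
under eq_bigr => s _ do rewrite mulrCA.
rewrite -mulr_sumr (sum_ffun_marg y (fun x2 => W3 (l v) x2 y z) (kap1 v)) mulr_sumr.
by apply: eq_bigr => x2 _; rewrite mulrA akap.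
Qed.

Let sum_q x y : \sum_s q x y s = px x * W2 x y.
Proof.
rewrite exchange_big -bW2; apply: eq_bigr => v _ /=.
by rewrite -mulr_sumr c1 mulr1.
Qed.

Let pu_pmf x y : is_pmf (pu x y).
Proof.
rewrite /pu; case: eqVneq => [_|pn]; split => [s|].
- by [].
- by rewrite -[RHS](sum_delta (fun=> 1) ([ffun=> x20] : S)); apply: eq_bigr => s _; rewrite mul1r.
- by rewrite divr_ge0 // mulr_ge0.
- by rewrite -mulr_suml sum_q divff.
Qed.

Let qE x y s : q x y s = px x * W2 x y * pu x y s.
Proof.
rewrite /pu; case: eqVneq => [p0|pn]; last by rewrite mulrCA divff // mulr1.
by rewrite p0 mul0r; apply: (sum_eq0_ge0 (q0 x y)); rewrite sum_q.
Qed.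

(** Given v the strategy is independent of y, so conditioning on it keeps the entropy of y, while by
    Jensen's inequality it cannot raise that of z. *)
Let gap_v v :
  \sum_y nxlnx (a v y) - \sum_z nxlnx (r v z) <=
  \sum_s (\sum_y nxlnx (a v y * c v s) - \sum_z nxlnx (c v s * rs v s z)).
Proof.
have -> : \sum_s (\sum_y nxlnx (a v y * c v s) - \sum_z nxlnx (c v s * rs v s z)) =
    \sum_y nxlnx (a v y) - \sum_z \sum_s c v s * nxlnx (rs v s z).
  rewrite [X in _ - X]exchange_big /= -[X in X - _]mul1r -(c1 v) mulr_suml -sumrB.
  apply: eq_bigr => s _.
  under eq_bigr => y _ do rewrite nxlnxM //.
  under [X in _ - X]eq_bigr => z _ do rewrite nxlnxM //.
  rewrite !big_split /= -!mulr_suml -!mulr_sumr.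
  have -> : \sum_z rs v s z = \sum_y a v y.
    by rewrite exchange_big; apply: eq_bigr => y _; rewrite -mulr_sumr W31 mulr1.
  ring.
rewrite lerD2l lerN2; apply: ler_sum => z _; rewrite -sum_c_rs.
by apply: nxlnx_jensen.
Qed.

(** All [v] with [l v = x] share the kernel [W3 x (s y) y] once [s] is fixed, so superadditivity
    merges them; the weights are set to zero for the other [v]. *)
Let gap_xs x s :
  \sum_(v | l v == x) (\sum_y nxlnx (a v y * c v s) - \sum_z nxlnx (c v s * rs v s z)) <=
  \sum_y nxlnx (q x y s) - \sum_z nxlnx (\sum_y q x y s * W3 x (s y) y z).
Proof.
pose p v y := if l v == x then a v y * c v s else 0.
have p0 v y : 0 <= p v y by rewrite /p; case: ifP => // _; rewrite mulr_ge0.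
have qp y : q x y s = \sum_v p v y by rewrite /q big_mkcond.
have := entropy_gap_superadd p0 (fun y => HW3 x (s y) y).
rewrite [X in _ <= X - _ -> _](eq_bigr (fun y => nxlnx (q x y s))) => [|y _]; last by rewrite qp.
rewrite [X in _ <= _ - X -> _](eq_bigr (fun z =>
  nxlnx (\sum_y q x y s * W3 x (s y) y z))) => [|z _]; last first.
  rewrite exchange_big; congr nxlnx; apply: eq_bigr => y _ /=.
  by rewrite qp -mulr_suml.
apply: le_trans; rewrite big_mkcond; apply: ler_sum => v _ /=; rewrite /p.
case: eqP => [<-|_].
  rewrite lerD2l lerN2; apply: ler_sum => z _; rewrite /rs mulr_sumr.
  have -> // : \sum_y c v s * (a v y * W3 (l v) (s y) y z) =
    \sum_y a v y * c v s * W3 (l v) (s y) y z.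
  by apply: eq_bigr => y _; ring.
rewrite !big1 ?subrr // => [z _|y _]; last exact: nxlnx0.
by rewrite big1 ?nxlnx0 // => y _; rewrite mul0r.
Qed.

Lemma strategy_bound : exists pu : X -> Y -> S -> R,
  (forall x y, is_pmf (pu x y)) /\
  \sum_z nxlnx (\sum_v \sum_y \sum_x2 b v y x2 * W3 (l v) x2 y z)
  - \sum_x px x * \sum_y nxlnx (W2 x y)
  + \sum_v (\sum_y nxlnx (\sum_x2 b v y x2) -
            \sum_z nxlnx (\sum_y \sum_x2 b v y x2 * W3 (l v) x2 y z))
  <= receiver_rate px W2 pu W3 strategy.
Proof.
exists pu; split; first exact: pu_pmf.
rewrite (@receiver_rate_jointE R X Y _ X2 Z px W2 pu W3 strategy Hpx HW2 pu_pmf HW3 q qE).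
(* The output law is preserved, so H(Y3) is the same on both sides and only the gaps have to be
   compared. *)
have -> : \sum_z nxlnx (\sum_x \sum_s \sum_y q x y s * W3 x (strategy s x y) y z) =
    \sum_z nxlnx (\sum_v r v z).
  apply: eq_bigr => z _; congr nxlnx; rewrite (partition_big l predT) //=.
  apply: eq_bigr => x _.
  transitivity (\sum_(v | l v == x) \sum_s c v s * rs v s z); last first.
    by apply: eq_bigr => v _.
  rewrite [RHS]exchange_big /=; apply: eq_bigr => s _ /=.
  rewrite /q; under eq_bigr => y _ do rewrite mulr_suml.
  rewrite exchange_big; apply: eq_bigr => v /eqP <- /=.
  by rewrite /rs mulr_sumr; apply: eq_bigr => y _; rewrite /strategy; ring.
rewrite -!addrA lerD2l addrC lerD2r.
rewrite (partition_big l predT) //=; apply: ler_sum => x _.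
apply: (@le_trans _ _ (\sum_s \sum_(v | l v == x)
    (\sum_y nxlnx (a v y * c v s) - \sum_z nxlnx (c v s * rs v s z)))); last first.
  by apply: ler_sum => s _; apply: gap_xs.
by rewrite exchange_big; apply: ler_sum => v _; apply: gap_v.
Qed.

End Strategies.

(** * Converse *)

Section EntropyOfVariable.
Variables (R : realType) (T : finType) (P : T -> R).
Hypothesis HP : is_pmf P.

Let P0 t : 0 <= P t. Proof. by case: HP. Qed.
Let P1 : \sum_t P t = 1. Proof. by case: HP. Qed.

Lemma probI (E : pred T) : prob P E = \sum_t P t * (E t)%:R.
Proof.
by rewrite /prob big_mkcond; apply: eq_bigr => t _; case: (E t); rewrite ?mulr1 ?mulr0.
Qed.

Lemma prob_ge0 (E : pred T) : 0 <= prob P E.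
Proof. exact: sumr_ge0. Qed.

Lemma prob_gt0 (E : pred T) t : E t -> 0 < P t -> 0 < prob P E.
Proof.
move=> Et Pt; rewrite probI; apply: (@sum_gt0_ge _ _ _ t) => [s|].
  by rewrite mulr_ge0.
by rewrite Et mulr1.
Qed.

Lemma sum_prob (A : finType) (f : T -> A) (g : A -> R) :
  \sum_a prob P [pred t | f t == a] * g a = \sum_t P t * g (f t).
Proof.
rewrite [RHS](partition_big f predT) //=; apply: eq_bigr => a _.
by rewrite /prob mulr_suml; apply: eq_bigr => t /eqP <-.
Qed.

Lemma sum_prob1 (A : finType) (f : T -> A) : \sum_a prob P [pred t | f t == a] = 1.
Proof.
rewrite -P1 -[RHS](eq_bigr _ (fun t _ => mulr1 (P t))) -(sum_prob f (fun=> 1)).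
by apply: eq_bigr => a _; rewrite mulr1.
Qed.

Definition entropy (A : finType) (f : T -> A) :=
  \sum_a nxlnx (prob P [pred t | f t == a]).

Lemma entropyE (A : finType) (f : T -> A) :
  entropy f = - \sum_t P t * ln (prob P [pred s | f s == f t]).
Proof.
rewrite -(sum_prob f (fun a => ln (prob P [pred s | f s == a]))) -sumrN.
by apply: eq_bigr.
Qed.

Lemma entropy_fiber (A B : finType) (f : T -> A) (g : T -> B) :
  (forall s t, (f s == f t) = (g s == g t)) -> entropy f = entropy g.
Proof.
move=> fg; rewrite !entropyE; congr (- _); apply: eq_bigr => t _.
by congr (_ * ln _); apply: eq_bigl => s /=; rewrite fg.
Qed.

(** Gibbs' inequality against the product of the marginals. *)
Lemma entropy_ffun_le (n : nat) (A : finType) (F : T -> {ffun 'I_n -> A}) :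
  entropy F <= \sum_i entropy (fun t => F t i).
Proof.
pose p i a := prob P [pred t | F t i == a].
pose q (y : {ffun 'I_n -> A}) := \prod_i p i (y i).
have p0 i a : 0 <= p i a by apply: prob_ge0.
have q0 y : 0 <= q y by apply: prodr_ge0.
have pq y : 0 < prob P [pred t | F t == y] -> 0 < q y.
  move=> py; apply: prodr_gt0 => i _; apply: lt_le_trans py _.
  rewrite /p !probI; apply: ler_sum => t _; rewrite ler_wpM2l // ler_nat.
  by rewrite /=; case: (eqVneq (F t) y) => //= ->; rewrite eqxx.
have := gibbs (fun y => prob_ge0 _) q0 pq.
rewrite sum_prob1 /q sum_ffun_prod big1 => [|i _]; last exact: sum_prob1.
rewrite lexx => /(_ isT).
rewrite (sum_prob F (fun y => ln (\prod_i p i (y i)))).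
rewrite -lerN2 => H; apply: (@le_trans _ _ (- \sum_y prob P [pred t | F t == y] *
   ln (prob P [pred t | F t == y]))).
  by rewrite -sumrN; apply: ler_sum => y _.
apply: (le_trans H); under [leRHS]eq_bigr => i _ do rewrite entropyE.
rewrite sumrN lerN2 exchange_big; apply: ler_sum => t _ /=; rewrite -mulr_sumr.
have := P0 t; rewrite le_eqVlt => /predU1P[<-|Pt]; first by rewrite !mul0r.
rewrite ln_prod // => i; rewrite /p; apply: (@prob_gt0 _ t) => //=.
Qed.

End EntropyOfVariable.

(** * Fano's inequality and single-letterization for one code *)

Section Converse.
Variables (R : realType) (X1 X2 Y2 Y3 : finType) (n M : nat).
Variables (W2 : X1 -> Y2 -> R) (W3 : X1 -> X2 -> Y2 -> Y3 -> R).
Hypothesis HW2 : forall x1, is_pmf (W2 x1).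
Hypothesis HW3 : forall x1 x2 y2, is_pmf (W3 x1 x2 y2).
Hypothesis Hdeg : forall x1 x1' x2 y2 y3, W3 x1 x2 y2 y3 = W3 x1' x2 y2 y3.
Hypotheses (n_gt0 : (0 < n)%N) (M_gt0 : (0 < M)%N).
Variable c : relay_code X1 X2 Y2 Y3 n M.

Let W20 x y : 0 <= W2 x y. Proof. by case: (HW2 x). Qed.
Let W21 x : \sum_y W2 x y = 1. Proof. by case: (HW2 x). Qed.
Let W30 x x2 y z : 0 <= W3 x x2 y z. Proof. by case: (HW3 x x2 y). Qed.
Let W31 x x2 y : \sum_z W3 x x2 y z = 1. Proof. by case: (HW3 x x2 y). Qed.

Let Y2n := {ffun 'I_n -> Y2}.
Let Y3n := {ffun 'I_n -> Y3}.
Let Om := ('I_M * Y2n * Y3n)%type.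
Let w2 m (y2 : Y2n) := \prod_i W2 (enc c m i) (y2 i).
Let w3 m (y2 : Y2n) (y3 : Y3n) := \prod_i W3 (enc c m i) (relay c y2 i) (y2 i) (y3 i).
Let P (t : Om) := M%:R^-1 * w2 t.1.1 t.1.2 * w3 t.1.1 t.1.2 t.2.
Let Msg (t : Om) := t.1.1.
Let Out2 (t : Om) := t.1.2.
Let Out3 (t : Om) := t.2.
Let x1 (t : Om) i := enc c (Msg t) i.
Let x2 (t : Om) i := relay c (Out2 t) i.

Let nr : 0 < n%:R :> R. Proof. by rewrite ltr0n. Qed.
Let Mr : 0 < M%:R :> R. Proof. by rewrite ltr0n. Qed.
Let iM : 0 < M%:R^-1 :> R. Proof. by rewrite invr_gt0. Qed.
Let w20 m y2 : 0 <= w2 m y2. Proof. exact: prodr_ge0. Qed.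
Let w30 m y2 y3 : 0 <= w3 m y2 y3. Proof. exact: prodr_ge0. Qed.
Let w21 m : \sum_y2 w2 m y2 = 1.
Proof. by rewrite (sum_ffun_prod (fun i => W2 (enc c m i))) big1. Qed.
Let w31 m y2 : \sum_y3 w3 m y2 y3 = 1.
Proof. by rewrite (sum_ffun_prod (fun i => W3 (enc c m i) (relay c y2 i) (y2 i))) big1. Qed.

Let sumP (g : 'I_M -> Y2n -> Y3n -> R) :
  \sum_t P t * g (Msg t) (Out2 t) (Out3 t) =
  \sum_m \sum_y2 M%:R^-1 * w2 m y2 * \sum_y3 w3 m y2 y3 * g m y2 y3.
Proof.
rewrite -(pair_bigA _ (fun my y3 => P (my, y3) * g my.1 my.2 y3)) /=.
rewrite -(pair_bigA _ (fun m y2 => \sum_y3 P (m, y2, y3) * g m y2 y3)) /=.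
do 2 (apply: eq_bigr => ? _); rewrite mulr_sumr; apply: eq_bigr => y3 _.
by rewrite /P !mulrA.
Qed.

Let P0 t : 0 <= P t. Proof. by rewrite !mulr_ge0 // ltW. Qed.

Let P_pmf : is_pmf P.
Proof.
split=> //; transitivity (\sum_t P t * 1); first by apply: eq_bigr => *; rewrite mulr1.
rewrite (sumP (fun _ _ _ => 1)).
transitivity (\sum_(m < M) M%:R^-1 : R).
  apply: eq_bigr => m _; under eq_bigr => y2 _.
    under eq_bigr => y3 _ do rewrite mulr1.
    rewrite w31 mulr1; over.
  by rewrite -mulr_sumr w21 mulr1.
by rewrite sumr_const card_ord -[LHS]mulr_natr mulVf ?gt_eqF.
Qed.

Let P_gt0 t : 0 < P t -> 0 < w2 (Msg t) (Out2 t) /\ 0 < w3 (Msg t) (Out2 t) (Out3 t).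
Proof.
rewrite lt_def /P !mulf_eq0 !negb_or -!andbA => /and4P[_ w2n w3n _].
by rewrite !lt_def w2n w3n w20 w30.
Qed.

Let Pe := err_prob W2 W3 c.

Let PeE : Pe = \sum_t P t * (dec c (Out3 t) != Some (Msg t))%:R.
Proof.
rewrite (sumP (fun m _ y3 => (dec c y3 != Some m)%:R)) /Pe /err_prob mulr_sumr.
apply: eq_bigr => m _; rewrite mulr_sumr; apply: eq_bigr => y2 _.
rewrite -mulrA; congr (_ * _); rewrite mulr_sumr big_mkcond; apply: eq_bigr => y3 _ /=.
by case: (dec c y3 != Some m); rewrite ?mulr1 ?mulr0.
Qed.

(* Gibbs' inequality against this test posterior yields Fano's inequality. *)
Let post (m : 'I_M) (y3 : Y3n) : R := if dec c y3 == Some m then 1 / 2 else (2 * M%:R)^-1.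

Let post_gt0 m y3 : 0 < post m y3.
Proof. by rewrite /post; case: ifP => _; rewrite ?divr_gt0 // invr_gt0 mulr_gt0. Qed.

(** Half of the mass is for the decoded message and half for a uniform guess; if the decoder
    declares an error, only the second half is present. *)
Let sum_post y3 : \sum_m post m y3 <= 1.
Proof.
have -> : 1 = \sum_(m < M) (2 * M%:R)^-1 + 1 / 2 :> R.
  by rewrite sumr_const card_ord -[_^-1 *+ _]mulr_natr; field; rewrite gt_eqF.
have ip : 0 < (2 * M%:R)^-1 :> R by rewrite invr_gt0 mulr_gt0.
rewrite /post; case: (dec c y3) => [m0|]; last first.
  by rewrite lerDl divr_ge0.
rewrite (bigD1 m0) //= eqxx addrC; apply: lerD => //.
rewrite [leRHS](bigD1 m0) //= -[leLHS]add0r; apply: lerD; first exact: ltW.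
rewrite le_eqVlt; apply/orP; left; apply/eqP; apply: eq_bigr => m mn.
by rewrite ifN //; apply: contra mn => /eqP[->].
Qed.

(** A wrong estimate costs a further ln M. The constant ln 2 stands where Fano's inequality has the
    binary entropy. *)
Let mean_ln_post : \sum_t P t * ln (post (Msg t) (Out3 t)) = - ln 2 - Pe * ln M%:R.
Proof.
have [_ PP1] := P_pmf.
rewrite PeE mulr_suml -[ln 2]mul1r -{1}PP1 mulr_suml -!sumrN -big_split.
apply: eq_bigr => t _ /=; rewrite /post.
case: eqP => _ /=; first by rewrite div1r lnV ?posrE // mulr0 mul0r; ring.
by rewrite lnV ?posrE ?mulr_gt0 // lnM ?posrE // mulr1; ring.
Qed.

Let Ln2 := \sum_t P t * \sum_i ln (W2 (x1 t i) (Out2 t i)).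

Let ln_w2 t : 0 < P t -> ln (w2 (Msg t) (Out2 t)) = \sum_i ln (W2 (x1 t i) (Out2 t i)).
Proof.
move=> /P_gt0[wp _]; rewrite ln_prod // => i; rewrite lt_def W20 andbT.
have /prodf_neq0 := lt0r_neq0 wp; exact.
Qed.

(** The right side is I(M;Y2^n). The test law draws y2, then y3 through the channel, then guesses
    the message from y3; since degradedness makes [w3] the same for all messages, the sum over
    messages meets [post] alone and the mass is at most one. *)
Let fano_relay : (1 - Pe) * ln M%:R - ln 2 <= entropy P Out2 + Ln2.
Proof.
have [_ PP1] := P_pmf.
pose p2 y2 := prob P [pred s | Out2 s == y2].
pose q (t : Om) := p2 (Out2 t) * w3 (Msg t) (Out2 t) (Out3 t) * post (Msg t) (Out3 t).
have q0 t : 0 <= q t by rewrite !mulr_ge0 ?prob_ge0 // ltW.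
have p2P t : 0 < P t -> 0 < p2 (Out2 t) by move=> Pt; apply: (@prob_gt0 _ _ _ P_pmf _ t) => /=.
have Pq t : 0 < P t -> 0 < q t.
  by move=> Pt; have [_ ?] := P_gt0 Pt; rewrite !mulr_gt0 ?p2P.
have m0 : 'I_M := Ordinal M_gt0.
have sq : \sum_t q t <= \sum_t P t.
  rewrite PP1 -(sum_prob1 P_pmf Out2).
  rewrite -(pair_bigA _ (fun my y3 => q (my, y3))) /=.
  rewrite -(pair_bigA _ (fun m y2 => \sum_y3 q (m, y2, y3))) /= exchange_big.
  apply: ler_sum => y2 _ /=; rewrite exchange_big /=.
  rewrite -[leRHS]mulr1 -(w31 m0 y2) mulr_sumr; apply: ler_sum => y3 _.
  rewrite /q /Out2 /Out3 /Msg /= (eq_bigr (fun m => p2 y2 * w3 m0 y2 y3 * post m y3)); last first.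
    by move=> m _; congr (_ * _ * _); apply: eq_bigr => i _; apply: Hdeg.
  by rewrite -mulr_sumr -[leRHS]mulr1 ler_wpM2l // mulr_ge0 ?prob_ge0.
have := gibbs P0 q0 Pq sq.
have -> : \sum_t P t * ln (q t) = - entropy P Out2
   + \sum_t P t * ln (w3 (Msg t) (Out2 t) (Out3 t)) + (- ln 2 - Pe * ln M%:R).
  rewrite -mean_ln_post entropyE // opprK -!big_split; apply: eq_bigr => t _ /=.
  have := P0 t; rewrite le_eqVlt => /predU1P[<-|Pt]; first by rewrite !mul0r !addr0.
  have [? ?] := P_gt0 Pt.
  by rewrite -!mulrDr /q !lnM ?posrE ?mulr_gt0 ?p2P.
have -> : \sum_t P t * ln (P t) = - ln M%:R + Ln2 +
   \sum_t P t * ln (w3 (Msg t) (Out2 t) (Out3 t)).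
  have -> : - ln M%:R = \sum_t P t * - ln M%:R by rewrite -mulr_suml PP1 mul1r.
  rewrite -!big_split; apply: eq_bigr => t _ /=.
  have := P0 t; rewrite le_eqVlt => /predU1P[<-|Pt].
    by rewrite !mul0r !addr0.
  have [? ?] := P_gt0 Pt.
  rewrite -!mulrDr -ln_w2 // {2}/P !lnM ?posrE ?mulr_gt0 // lnV ?posrE //.
lra.
Qed.

(** The right side is I(M;Y3^n), with the joint entropy of message and output kept whole because it
    is the end point of the telescoping sum. *)
Let fano_receiver : (1 - Pe) * ln M%:R - ln 2 <=
  ln M%:R + entropy P Out3 - entropy P (fun t => (Msg t, Out3 t)).
Proof.
pose p3 y3 := prob P [pred s | Out3 s == y3].
pose p (my : 'I_M * Y3n) := prob P [pred s | (Msg s, Out3 s) == my].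
pose q (my : 'I_M * Y3n) := p3 my.2 * post my.1 my.2.
have p0 my : 0 <= p my by apply: prob_ge0.
have q0 my : 0 <= q my by rewrite mulr_ge0 ?prob_ge0 // ltW.
have pq my : 0 < p my -> 0 < q my.
  move=> pm; rewrite mulr_gt0 //; apply: (lt_le_trans pm).
  rewrite /p /p3 !probI; apply: ler_sum => t _; rewrite ler_wpM2l // ler_nat /=.
  by rewrite /=; case: (eqVneq (Msg t, Out3 t) my) => //= <-; rewrite eqxx.
have sq : \sum_my q my <= \sum_my p my.
  rewrite sum_prob1 // -(sum_prob1 P_pmf Out3).
  rewrite -(pair_bigA _ (fun m y3 => q (m, y3))) /= exchange_big; apply: ler_sum => y3 _ /=.
  by rewrite /q /= -mulr_sumr -[leRHS]mulr1 ler_wpM2l ?prob_ge0.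
have := gibbs p0 q0 pq sq.
rewrite (sum_prob P (fun t => (Msg t, Out3 t)) (fun my => ln (q my))).
rewrite (sum_prob P (fun t => (Msg t, Out3 t)) (fun my => ln (p my))).
have -> : \sum_t P t * ln (q (Msg t, Out3 t)) = - entropy P Out3 + (- ln 2 - Pe * ln M%:R).
  rewrite -mean_ln_post entropyE // opprK -!big_split; apply: eq_bigr => t _ /=.
  have := P0 t; rewrite le_eqVlt => /predU1P[<-|Pt]; first by rewrite !mul0r !addr0.
  rewrite -!mulrDr /q lnM ?posrE //.
  by apply: (@prob_gt0 _ _ _ P_pmf _ t) => /=.
rewrite (entropyE P (fun t => (Msg t, Out3 t))) /p /=; lra.
Qed.

Let hyb (i : nat) (t : Om) : 'I_M * {ffun 'I_n -> Y2 + Y3} :=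
  (Msg t, [ffun j : 'I_n => if (j < i)%N then inr (Out3 t j) else inl (Out2 t j)]).

Let Aux := ('I_M * {ffun 'I_n -> option (Y2 + Y3)})%type.

(** U_i as a hybrid whose coordinate [i] is erased by [None]: putting y2_i back gives [hyb i],
    putting y3_i back gives [hyb i.+1]. *)
Let aux (i : 'I_n) (t : Om) : Aux :=
  (Msg t, [ffun j : 'I_n => if j == i then None else Some ((hyb i t).2 j)]).

Let hyb0 : entropy P (hyb 0) = entropy P (fun t => (Msg t, Out2 t)).
Proof.
apply: entropy_fiber => // s t; rewrite !xpair_eqE; congr (_ && _).
apply/eqP/eqP => [/ffunP e|->//]; apply/ffunP => j.
by have := e j; rewrite !ffunE ltn0 => -[].
Qed.

Let hybn : entropy P (hyb n) = entropy P (fun t => (Msg t, Out3 t)).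
Proof.
apply: entropy_fiber => // s t; rewrite !xpair_eqE; congr (_ && _).
apply/eqP/eqP => [/ffunP e|->]; apply/ffunP => j.
  by have := e j; rewrite !ffunE ltn_ord => -[].
by rewrite !ffunE !ltn_ord.
Qed.

Let hyb_aux2 (i : 'I_n) : entropy P (hyb i) = entropy P (fun t => (aux i t, Out2 t i)).
Proof.
apply: entropy_fiber => // s t; rewrite !xpair_eqE -andbA; congr (_ && _).
apply/eqP/andP => [/ffunP e|[/eqP/ffunP e /eqP ei]].
  split; last by have := e i; rewrite !ffunE ltnn => -[->].
  by apply/eqP/ffunP => j; have := e j; rewrite !ffunE; case: eqP => // _ ->.
apply/ffunP => j; have := e j; rewrite !ffunE; case: eqP => [->|_ []//] _.
by rewrite ltnn ei.
Qed.

Let hyb_aux3 (i : 'I_n) : entropy P (hyb i.+1) = entropy P (fun t => (aux i t, Out3 t i)).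
Proof.
have lt_neq (j : 'I_n) : j != i -> (j < i.+1)%N = (j < i)%N.
  by move=> ji; rewrite ltnS leq_eqVlt (inj_eq val_inj) (negbTE ji).
apply: entropy_fiber => // s t; rewrite !xpair_eqE -andbA; congr (_ && _).
apply/eqP/andP => [/ffunP e|[/eqP/ffunP e /eqP ei]].
  split; last by have := e i; rewrite !ffunE ltnSn => -[->].
  apply/eqP/ffunP => j; have := e j; rewrite !ffunE.
  by have [//|ji] := eqVneq j i; rewrite lt_neq // => ->.
apply/ffunP => j; have := e j; rewrite !ffunE.
have [->|ji] := eqVneq j i; first by rewrite ltnSn ei.
by rewrite lt_neq // => -[].
Qed.

Let csiszar_sum :
  entropy P (fun t => (Msg t, Out3 t)) = entropy P (fun t => (Msg t, Out2 t)) -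
  \sum_(i < n) (entropy P (fun t => (aux i t, Out2 t i)) -
                entropy P (fun t => (aux i t, Out3 t i))).
Proof.
rewrite -hyb0 -hybn.
under [X in _ - X]eq_bigr => i _ do rewrite -hyb_aux2 -hyb_aux3 -opprB.
rewrite sumrN opprK -(big_mkord predT (fun i => entropy P (hyb i.+1) - entropy P (hyb i))).
by rewrite telescope_sumr // addrC subrK.
Qed.

Let entropy_Msg_Out2 : entropy P (fun t => (Msg t, Out2 t)) = ln M%:R - Ln2.
Proof.
have [_ PP1] := P_pmf.
have prob_w2 m y2 : prob P [pred s | (Msg s, Out2 s) == (m, y2)] = M%:R^-1 * w2 m y2.
  rewrite probI (sumP (fun m' y2' y3 => ((m', y2') == (m, y2))%:R)).
  rewrite -[RHS](sum_delta2 (fun m y2 => M%:R^-1 * w2 m y2) m y2).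
  do 2 (apply: eq_bigr => ? _); rewrite -mulr_suml w31 mul1r xpair_eqE //.
rewrite entropyE //.
have -> : ln M%:R = \sum_t P t * ln M%:R by rewrite -mulr_suml PP1 mul1r.
rewrite -sumrN -sumrB; apply: eq_bigr => t _; rewrite prob_w2.
have := P0 t; rewrite le_eqVlt => /predU1P[<-|Pt]; first by rewrite !mul0r subr0 oppr0.
have [? _] := P_gt0 Pt.
by rewrite -ln_w2 // lnM ?posrE // lnV ?posrE //; ring.
Qed.

Let V := ('I_n * Aux)%type.
Let l (v : V) := enc c v.2.1 v.1.
Let b (v : V) y x : R :=
  n%:R^-1 * prob P [pred t | [&& aux v.1 t == v.2, Out2 t v.1 == y & x2 t v.1 == x]].
Let px x : R := n%:R^-1 * \sum_i M%:R^-1 * \sum_m (enc c m i == x)%:R.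

Let px_mean (h : X1 -> R) :
  \sum_x px x * h x = n%:R^-1 * \sum_i M%:R^-1 * \sum_m h (enc c m i).
Proof.
under eq_bigr => x _ do rewrite /px -mulrA mulr_suml.
rewrite -[LHS]mulr_sumr exchange_big; congr (_ * _); apply: eq_bigr => i _ /=.
under eq_bigr => x _ do rewrite -mulrA mulr_suml.
rewrite -[LHS]mulr_sumr exchange_big; congr (_ * _); apply: eq_bigr => m _ /=.
rewrite -[RHS](sum_delta h); apply: eq_bigr => x _.
by rewrite mulrC eq_sym.
Qed.

Let px_pmf : is_pmf px.
Proof.
split=> [x|].
  rewrite mulr_ge0 ?invr_ge0 ?(ltW nr) //; apply: sumr_ge0 => i _.
  by rewrite mulr_ge0 ?(ltW iM) //; apply: sumr_ge0.
transitivity (\sum_x px x * 1); first by apply: eq_bigr => *; rewrite mulr1.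
rewrite (px_mean (fun=> 1)).
have e : M%:R^-1 * (\sum_(m < M) 1) = 1 :> R by rewrite sumr_const card_ord mulVf ?gt_eqF.
under eq_bigr => i _ do rewrite e.
by rewrite sumr_const card_ord mulVf ?gt_eqF.
Qed.

Let mean_Out2 (i : 'I_n) (h : 'I_M -> Y2 -> R) :
  \sum_t P t * h (Msg t) (Out2 t i) =
  M%:R^-1 * \sum_m \sum_y W2 (enc c m i) y * h m y.
Proof.
rewrite (sumP (fun m y2 _ => h m (y2 i))) mulr_sumr; apply: eq_bigr => m _.
under eq_bigr => y2 _ do rewrite -mulr_suml w31 mul1r -mulrA.
by rewrite -mulr_sumr (sum_ffun_marg i (h m) (fun j => W21 (enc c m j))).
Qed.

Let sum_b_x2 v y : \sum_x b v y x =
  n%:R^-1 * prob P [pred t | (aux v.1 t, Out2 t v.1) == (v.2, y)].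
Proof.
rewrite -mulr_sumr; congr (_ * _).
under eq_bigr => x _ do rewrite probI.
rewrite exchange_big probI; apply: eq_bigr => t _ /=; rewrite -mulr_sumr; congr (_ * _).
rewrite xpair_eqE -[RHS](sum_delta (fun=> _) (x2 t v.1)); apply: eq_bigr => x _.
by rewrite andbA -mulnb natrM [x == _]eq_sym.
Qed.

Let b_W2 x y : \sum_(v | l v == x) \sum_x' b v y x' = px x * W2 x y.
Proof.
under eq_bigr => v _ do rewrite sum_b_x2.
rewrite -mulr_sumr.
have -> : px x * W2 x y = \sum_x' px x' * (W2 x' y * (x' == x)%:R).
  rewrite -[LHS](sum_delta (fun x => px x * W2 x y)).
  by apply: eq_bigr => x' _; rewrite mulrA.
rewrite px_mean; congr (_ * _).
rewrite big_mkcond -(pair_bigA _ (fun i u => if l (i, u) == x then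
  prob P [pred t | (aux i t, Out2 t i) == (u, y)] else 0)) /=.
apply: eq_bigr => i _.
transitivity (\sum_t P t * ((enc c (Msg t) i == x)%:R * (Out2 t i == y)%:R)).
  transitivity (\sum_u \sum_t P t * ((l (i, u) == x)%:R * ((aux i t == u)%:R * (Out2 t i == y)%:R))).
    apply: eq_bigr => u _; case: eqP => _; last first.
      by rewrite big1 // => t _; rewrite mul0r mulr0.
    rewrite probI; apply: eq_bigr => t _ /=; rewrite mul1r xpair_eqE -mulnb natrM //.
  rewrite exchange_big; apply: eq_bigr => t _ /=; rewrite -mulr_sumr; congr (_ * _).
  rewrite -[RHS](sum_delta (fun u => (l (i, u) == x)%:R * (Out2 t i == y)%:R) (aux i t)).
  by apply: eq_bigr => u _; rewrite [u == _]eq_sym; ring.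
rewrite (mean_Out2 i (fun m y' => (enc c m i == x)%:R * (y' == y)%:R)).
congr (_ * _); apply: eq_bigr => m _.
rewrite -[RHS](sum_delta (fun y => W2 (enc c m i) y * (enc c m i == x)%:R)).
by apply: eq_bigr => y' _; rewrite mulrA.
Qed.

Let aux_upd i (m : 'I_M) (y2 : Y2n) (y3 : Y3n) z :
  aux i (m, y2, ffun_upd y3 i z) = aux i (m, y2, y3).
Proof.
congr pair; apply/ffunP => j; rewrite !ffunE /=; case: eqP => // /eqP ji; rewrite ?ffunE ?(negbTE ji) //.
Qed.

(** Given the message and y2^n the outputs y3_j are independent, and U_i does not involve y3_i;
    hence y3_i can be averaged out through its kernel. *)
Let sum_b_Out3 v z : \sum_y \sum_x b v y x * W3 (l v) x y z =
  n%:R^-1 * prob P [pred t | (aux v.1 t, Out3 t v.1) == (v.2, z)].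
Proof.
case: v => i u.
have -> : prob P [pred t | (aux i t, Out3 t i) == (u, z)] =
  \sum_t P t * ((aux i t == u)%:R * W3 (x1 t i) (x2 t i) (Out2 t i) z).
  rewrite probI (sumP (fun m y2 y3 => ((aux i (m, y2, y3), y3 i) == (u, z))%:R)).
  rewrite (sumP (fun m y2 y3 => (aux i (m, y2, y3) == u)%:R *
     W3 (enc c m i) (relay c y2 i) (y2 i) z)).
  apply: eq_bigr => m _; apply: eq_bigr => y2 _; congr (_ * _).
  transitivity (\sum_y3 w3 m y2 y3 * ((y3 i == z)%:R * (aux i (m, y2, y3) == u)%:R)).
    by apply: eq_bigr => y3 _; rewrite xpair_eqE andbC -mulnb natrM.
  rewrite (@sum_ffun_indep R _ _ (fun j => W3 (enc c m j) (relay c y2 j) (y2 j)) i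
    (fun z' => (z' == z)%:R) (fun y3 => (aux i (m, y2, y3) == u)%:R)) => [||y3 z'].
  - rewrite sum_delta mulr_sumr; apply: eq_bigr => y3 _; rewrite /w3; ring.
  - exact: W31.
  - by rewrite aux_upd.
rewrite mulr_sumr.
under eq_bigr => y _ do under eq_bigr => x _ do rewrite /b probI mulr_sumr mulr_suml.
under eq_bigr => y _ do rewrite exchange_big.
rewrite exchange_big; apply: eq_bigr => t _ /=.
rewrite mulrA.
transitivity (\sum_y \sum_x (n%:R^-1 * P t * (aux i t == u)%:R * W3 (l (i, u)) x y z) *
   ((y == Out2 t i) && (x == x2 t i))%:R).
  apply: eq_bigr => y _; apply: eq_bigr => x _.
  by rewrite -!mulnb !natrM [y == _]eq_sym [x == _]eq_sym; ring.
rewrite (sum_delta2 (fun y x => n%:R^-1 * P t * (aux i t == u)%:R * W3 (l (i, u)) x y z)).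
case: eqP => [<-|_]; last by rewrite mulr0 !mul0r mulr0.
by rewrite mulr1 mul1r.
Qed.

Let Ln2E : \sum_x px x * \sum_y nxlnx (W2 x y) = - (n%:R^-1 * Ln2).
Proof.
rewrite px_mean -mulrN; congr (_ * _); rewrite /Ln2.
under [in RHS]eq_bigr => t _ do rewrite mulr_sumr.
rewrite exchange_big -sumrN; apply: eq_bigr => i _ /=.
rewrite (mean_Out2 i (fun m y => ln (W2 (enc c m i) y))) -mulrN -sumrN; congr (_ * _).
by apply: eq_bigr => m _; rewrite -sumrN.
Qed.

Let entropy_mix (A : finType) (F : Om -> 'I_n -> A) (p : A -> R) :
  (forall a, p a = n%:R^-1 * \sum_i prob P [pred t | F t i == a]) ->
  \sum_i entropy P (fun t => F t i) <= n%:R * \sum_a nxlnx (p a).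
Proof.
move=> pE; rewrite mulrC -ler_pdivrMr // mulrC mulr_sumr /entropy.
under eq_bigr => i _ do rewrite mulr_sumr.
rewrite exchange_big; apply: ler_sum => a _ /=; rewrite pE mulr_sumr.
apply: (@nxlnx_jensen R _ (fun=> n%:R^-1)) => [_|i|].
- by rewrite invr_ge0 ltW.
- exact: prob_ge0.
- by rewrite sumr_const card_ord -[LHS]mulr_natr mulVf ?gt_eqF.
Qed.

(** The extra [nxlnx k] is the same for y2 and for y3 and cancels in the difference. *)
Let entropy_scale (A : finType) (f : Om -> A) (k : R) : 0 <= k ->
  \sum_a nxlnx (k * prob P [pred t | f t == a]) = k * entropy P f + nxlnx k.
Proof.
move=> k0; under eq_bigr => a _ do rewrite nxlnxM ?prob_ge0 //.
by rewrite big_split /= -mulr_sumr -mulr_suml sum_prob1 // mul1r.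
Qed.

Lemma converse (x20 : X2) :
  exists (qx : X1 -> R) (pu : X1 -> Y2 -> {ffun Y2 -> X2} -> R),
  [/\ is_pmf qx, forall x y, is_pmf (pu x y),
   (1 - err_prob W2 W3 c) * ln M%:R - ln 2 <= n%:R * relay_rate qx W2 &
   (1 - err_prob W2 W3 c) * ln M%:R - ln 2 <=
     n%:R * receiver_rate qx W2 pu W3 (@strategy X1 Y2 X2)].
Proof.
have b0 v y x : 0 <= b v y x by rewrite mulr_ge0 ?prob_ge0 // invr_ge0 ltW.
have [pu [pu_pmf Hb]] := @strategy_bound R _ _ _ _ V px W2 W3 l b x20 px_pmf HW2 HW3 b0 b_W2.
have nn : n%:R * n%:R^-1 = 1 :> R by rewrite divff ?gt_eqF.
exists px, pu; split=> //.
- apply: (le_trans fano_relay).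
  rewrite /relay_rate mulrBr Ln2E mulrN opprK mulrA nn mul1r lerD2r.
  apply: le_trans (entropy_ffun_le P_pmf Out2) _.
  apply: entropy_mix => y; rewrite /outY (px_mean (fun x => W2 x y)); congr (_ * _).
  apply: eq_bigr => i _; rewrite probI (mean_Out2 i (fun _ y' => (y' == y)%:R)).
  congr (_ * _); apply: eq_bigr => m _; by rewrite sum_delta.
- apply: (le_trans fano_receiver).
  rewrite csiszar_sum entropy_Msg_Out2.
  apply: (@le_trans _ _ (n%:R * (\sum_z nxlnx (\sum_v \sum_y \sum_x b v y x * W3 (l v) x y z)
  - \sum_x px x * \sum_y nxlnx (W2 x y)
  + \sum_v (\sum_y nxlnx (\sum_x b v y x) -
            \sum_z nxlnx (\sum_y \sum_x b v y x * W3 (l v) x y z))))); last first.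
    by rewrite ler_pM2l.
  rewrite mulrDr mulrBr Ln2E mulrN opprK mulrA nn mul1r.
  have -> : n%:R * (\sum_v (\sum_y nxlnx (\sum_x b v y x) -
            \sum_z nxlnx (\sum_y \sum_x b v y x * W3 (l v) x y z))) =
    \sum_(i < n) (entropy P (fun t => (aux i t, Out2 t i)) -
                entropy P (fun t => (aux i t, Out3 t i))).
    rewrite mulr_sumr -(pair_bigA _ (fun i u => n%:R * (\sum_y nxlnx (\sum_x b (i, u) y x) -
            \sum_z nxlnx (\sum_y \sum_x b (i, u) y x * W3 (l (i, u)) x y z)))) /=.
    apply: eq_bigr => i _; rewrite -mulr_sumr sumrB.
    have k0 : 0 <= n%:R^-1 :> R by rewrite invr_ge0 ltW.
    have -> : \sum_u \sum_y nxlnx (\sum_x b (i, u) y x) =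
      n%:R^-1 * entropy P (fun t => (aux i t, Out2 t i)) + nxlnx n%:R^-1.
      rewrite -entropy_scale // pair_bigA /=; apply: eq_bigr => -[u y] _.
      by rewrite sum_b_x2.
    have -> : \sum_u \sum_z nxlnx (\sum_y \sum_x b (i, u) y x * W3 (l (i, u)) x y z) =
      n%:R^-1 * entropy P (fun t => (aux i t, Out3 t i)) + nxlnx n%:R^-1.
      rewrite -entropy_scale // pair_bigA /=; apply: eq_bigr => -[u z] _.
      by rewrite sum_b_Out3.
    by rewrite opprD addrACA subrr addr0 -mulrBr mulrA nn mul1r.
  have : entropy P Out3 <= n%:R * \sum_z nxlnx (\sum_v \sum_y \sum_x b v y x * W3 (l v) x y z).
    apply: le_trans (entropy_ffun_le P_pmf Out3) _.
    apply: entropy_mix => z; under eq_bigr => v _ do rewrite sum_b_Out3.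
    rewrite -mulr_sumr; congr (_ * _).
    rewrite -(pair_bigA _ (fun i u => prob P [pred t | (aux i t, Out3 t i) == (u, z)])) /=.
    apply: eq_bigr => i _; under eq_bigr => u _ do rewrite probI.
    rewrite exchange_big probI; apply: eq_bigr => t _ /=; rewrite -mulr_sumr; congr (_ * _).
    rewrite -[RHS](sum_delta (fun=> _) (aux i t)); apply: eq_bigr => u _.
    by rewrite xpair_eqE -mulnb natrM mulrC [u == _]eq_sym.
  lra.
Qed.

End Converse.

(** * Existence of the maximum *)

Section Continuity.
Variable R : realType.

(** For positive x this is ln t <= t - 1 at t = 1 / sqrt x; it provides continuity at 0. *)
Lemma nxlnx_bounds (x : R) : `|x| < 1 -> `|nxlnx x| <= 2 * Num.sqrt `|x|.
Proof.
move=> x1; have [x0|x0] := leP x 0.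
  by rewrite /nxlnx ln0 // mulr0 oppr0 normr0 mulr_ge0 // sqrtr_ge0.
have xx := ger0_norm (ltW x0); rewrite xx in x1 *.
set s := Num.sqrt x; have s0 : 0 < s by rewrite sqrtr_gt0.
have xs : x = s ^+ 2 by rewrite sqr_sqrtr // ltW.
have lx : ln x <= 0 by rewrite ln_le0 // ltW.
rewrite /nxlnx normrN ler0_norm; last by rewrite pmulr_rle0.
have : - ln s <= s^-1 - 1 by rewrite -lnV ?posrE // ln_le_sub1 // invr_gt0.
rewrite [in ln x]xs lnXn // => h.
apply: (@le_trans _ _ (2 * (x * (s^-1 - 1)))).
  have -> : - (x * (ln s *+ 2)) = 2 * (x * - ln s) by ring.
  by rewrite ler_pM2l // ler_pM2l.
by rewrite ler_pM2l // xs expr2 mulrBr -mulrA divff ?gt_eqF // !mulr1 lerBlDr lerDl mulr_ge0 // ltW.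
Qed.

Lemma continuous_nxlnx : continuous (@nxlnx R).
Proof.
move=> x; have [x0|x0|->] := ltgtP x 0.
- have e : \forall y \near x, 0 = nxlnx y.
    near=> y; rewrite /nxlnx ln0 ?mulr0 ?oppr0 // ltW //.
    by near: y; exact: lt_nbhsl.
  rewrite /continuous_at.
  have -> : nxlnx x = 0 by rewrite /nxlnx ln0 ?mulr0 ?oppr0 // ltW.
  by apply: cvg_trans (near_eq_cvg e) _; apply: cvg_cst.
- by apply: cvgN; apply: cvgM; [exact: cvg_id|exact: continuous_ln].
- apply/cvgrPdist_lt => e e0; rewrite nxlnx0.
  pose d := Num.min 1 ((e / 2) ^+ 2).
  have d0 : 0 < d by rewrite lt_min ltr01 exprn_gt0 // divr_gt0.
  exists d => //= y; rewrite /ball_ /= sub0r normrN lt_min => /andP[y1 ye].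
  rewrite sub0r normrN; apply: le_lt_trans (nxlnx_bounds y1) _.
  rewrite mulrC -ltr_pdivlMr //.
  have e2 : 0 < e / 2 by rewrite divr_gt0.
  by rewrite -[ltRHS](ger0_norm (ltW e2)) -[ltRHS]sqrtr_sqr ltr_sqrt // exprn_gt0.
Unshelve. all: by end_near.
Qed.

Variable T : topologicalType.
Implicit Types F G : T -> R.

Lemma continuous_sum (I : finType) (F : I -> T -> R) :
  (forall i, continuous (F i)) -> continuous (fun x => \sum_i F i x).
Proof. by move=> cF; apply: continuous_big => //; apply: add_continuous. Qed.

Lemma continuous_mul F G : continuous F -> continuous G ->
  continuous (fun x => F x * G x).
Proof. by move=> cF cG x; apply: cvgM; [apply: cF|apply: cG]. Qed.

Lemma continuous_sub F G : continuous F -> continuous G ->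
  continuous (fun x => F x - G x).
Proof. by move=> cF cG x; apply: cvgB; [apply: cF|apply: cG]. Qed.

Lemma continuous_add F G : continuous F -> continuous G ->
  continuous (fun x => F x + G x).
Proof. by move=> cF cG x; apply: cvgD; [apply: cF|apply: cG]. Qed.

Lemma continuous_comp_nxlnx F : continuous F -> continuous (fun x => nxlnx (F x)).
Proof. by move=> cF x; apply: continuous_comp; [apply: cF|apply: continuous_nxlnx]. Qed.

Lemma continuous_const (k : R) : continuous (fun _ : T => k).
Proof. by move=> x; apply: cvg_cst. Qed.

End Continuity.

Section Maximizer.
Variables (R : realType) (X1 X2 Y2 Y3 : finType).
Variables (W2 : X1 -> Y2 -> R) (W3 : X1 -> X2 -> Y2 -> Y3 -> R).

Let S := {ffun Y2 -> X2}.
Let T := (X1 + X1 * Y2 * S)%type.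
Let pxv (v : 'rV[R]_#|{: T}|) x := v ord0 (enum_rank (inl x : T)).
Let puv (v : 'rV[R]_#|{: T}|) x y s := v ord0 (enum_rank (inr (x, y, s) : T)).
Let value px pu := Num.min (relay_rate px W2) (receiver_rate px W2 pu W3 (@strategy X1 Y2 X2)).

Let cont_pxv x : continuous (fun v => pxv v x).
Proof. exact: coord_continuous. Qed.

Let cont_puv x y s : continuous (fun v => puv v x y s).
Proof. exact: coord_continuous. Qed.

Let cont_aux x s z :
  continuous (fun v => auxZ W2 (puv v) W3 (@strategy X1 Y2 X2) x s z).
Proof.
apply: continuous_sum => y; do 2 (apply: continuous_mul; last exact: continuous_const || exact: cont_puv).
exact: continuous_const.
Qed.

Let cont_value : continuous (fun v => value (pxv v) (puv v)).
Proof.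
have cA : continuous (fun v => relay_rate (pxv v) W2).
  apply: continuous_sub; apply: continuous_sum => i.
    apply: continuous_comp_nxlnx; apply: continuous_sum => x.
    by apply: continuous_mul; [exact: cont_pxv|exact: continuous_const].
  by apply: continuous_mul; [exact: cont_pxv|exact: continuous_const].
have cB : continuous (fun v => receiver_rate (pxv v) W2 (puv v) W3 (@strategy X1 Y2 X2)).
  apply: continuous_add; first apply: continuous_sub.
  - apply: continuous_sum => z; apply: continuous_comp_nxlnx.
    apply: continuous_sum => x; apply: continuous_sum => s.
    by apply: continuous_mul; [exact: cont_pxv|exact: cont_aux].
  - apply: continuous_sum => x; apply: continuous_mul; first exact: cont_pxv.
    apply: continuous_sum => s; apply: continuous_sum => z.
    by apply: continuous_comp_nxlnx; exact: cont_aux.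
  - apply: continuous_sum => x; apply: continuous_mul; first exact: cont_pxv.
    apply: continuous_sum => y; apply: continuous_mul; first exact: continuous_const.
    by apply: continuous_sum => s; apply: continuous_comp_nxlnx; exact: cont_puv.
move=> v; exact: (@continuous_min R _ _ _ v (cA v) (cB v)).
Qed.

Lemma pmf_le1 (A : finType) (p : A -> R) a : is_pmf p -> p a <= 1.
Proof. by case=> p0 <-; rewrite (bigD1 a) //= lerDl sumr_ge0. Qed.

Lemma pmf_delta (A : finType) (a : A) : is_pmf (fun b => (b == a)%:R : R).
Proof.
split=> // ; rewrite -[RHS](sum_delta (fun=> 1) a).
by apply: eq_bigr => b _; rewrite mul1r.
Qed.

Lemma max_value (x10 : X1) (x20 : X2) :
  exists (px : X1 -> R) (pu : X1 -> Y2 -> S -> R),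
  [/\ is_pmf px, forall x y, is_pmf (pu x y) &
   forall qx qu, is_pmf qx -> (forall x y, is_pmf (qu x y)) ->
     Num.min (relay_rate qx W2) (receiver_rate qx W2 qu W3 (@strategy X1 Y2 X2)) <=
     Num.min (relay_rate px W2) (receiver_rate px W2 pu W3 (@strategy X1 Y2 X2))].
Proof.
(* A sum of squares turns all normalizations into the zero set of one continuous function, which is
   closed; nonnegativity and boundedness come from [box]. *)
pose defect v := (\sum_x pxv v x - 1) * (\sum_x pxv v x - 1) +
  \sum_x \sum_y (\sum_s puv v x y s - 1) * (\sum_s puv v x y s - 1).
pose box : set 'rV[R]_#|{: T}| := [set v | forall i, `[0, 1]%classic (v ord0 i)]%classic.
pose A := (box `&` [set v | defect v = 0])%classic.
have defectP v : defect v = 0 <-> \sum_x pxv v x = 1 /\ forall x y, \sum_s puv v x y s = 1.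
  split=> [/eqP|[hx hu]]; last first.
    rewrite /defect hx subrr mulr0 add0r big1 // => x _; rewrite big1 // => y _.
    by rewrite hu subrr mulr0.
  rewrite /defect -!expr2 paddr_eq0 ?sqr_ge0 //; last first.
    by do 2 (apply: sumr_ge0 => ? _); rewrite -expr2 sqr_ge0.
  rewrite sqrf_eq0 subr_eq0 => /andP[/eqP hx /eqP hu]; split=> // x y.
  have h0 x' : 0 <= \sum_y (\sum_s puv v x' y s - 1) * (\sum_s puv v x' y s - 1).
    by apply: sumr_ge0 => y' _; rewrite -expr2 sqr_ge0.
  have := sum_eq0_ge0 h0 hu x => hux.
  have h1 y' : 0 <= (\sum_s puv v x y' s - 1) * (\sum_s puv v x y' s - 1).
    by rewrite -expr2 sqr_ge0.
  by have /eqP := sum_eq0_ge0 h1 hux y; rewrite mulf_eq0 orbb subr_eq0 => /eqP.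
have cdefect : continuous defect.
  have c2 (F : 'rV[R]_#|{: T}| -> R) : continuous F ->
      continuous (fun v => (F v - 1) * (F v - 1)).
    by move=> cF; apply: continuous_mul; apply: continuous_sub => //; exact: continuous_const.
  apply: continuous_add.
    by apply: c2; apply: continuous_sum => x; exact: cont_pxv.
  apply: continuous_sum => x; apply: continuous_sum => y.
  by apply: c2; apply: continuous_sum => s; exact: cont_puv.
have cbox : compact box.
  have := @rV_compact R _ (fun _ : (ordinal #|{: T}|) => `[0, 1]%classic).
  by apply => _; exact: segment_compact.
have cA : compact A.
  apply: (subclosed_compact _ cbox); last by move=> v [].
  apply: closedI; first by apply: (compact_closed _ cbox); exact: norm_hausdorff.
  by move/continuous_closedP : cdefect => /(_ [set x | x = 0]%classic); apply; exact: closed_eq.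
pose enc_v (px : X1 -> R) (pu : X1 -> Y2 -> S -> R) : 'rV[R]_#|{: T}| :=
  \row_i match enum_val i with inl x => px x | inr (x, y, s) => pu x y s end.
have enc_x px pu : pxv (enc_v px pu) = px.
  by apply/funext => x; rewrite /pxv mxE enum_rankK.
have enc_u px pu : puv (enc_v px pu) = pu.
  by apply/funext => x; apply/funext => y; apply/funext => s; rewrite /puv mxE enum_rankK.
have enc_A px pu : is_pmf px -> (forall x y, is_pmf (pu x y)) -> A (enc_v px pu).
  move=> Hpx Hpu; split; last first.
    apply/defectP; rewrite enc_x enc_u; split; first by case: Hpx.
    by move=> x y; case: (Hpu x y).
  move=> i; rewrite /= in_itv /= mxE.
  case: (enum_val i) => [x|[[x y] s]]; rewrite pmf_le1 ?andbT //; first by case: Hpx.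
  by case: (Hpu x y).
have A0 : (A !=set0)%classic.
  exists (enc_v (fun x => (x == x10)%:R) (fun _ _ s => (s == [ffun=> x20])%:R)).
  by apply: enc_A => [|*]; exact: pmf_delta.
have [|v vA vmax] := compact_EVT_max A0 cA (f := fun v => value (pxv v) (puv v)).
  exact: continuous_subspaceT.
move: vA; rewrite inE => -[vbox /defectP[vx vu]].
have v0 i : 0 <= v ord0 i by have := vbox i; rewrite /= in_itv /= => /andP[].
exists (pxv v), (puv v); split=> [|x y|qx qu Hqx Hqu].
- by split=> // x; exact: v0.
- by split=> // s; exact: v0.
- have := vmax (enc_v qx qu); rewrite enc_x enc_u; apply.
  by rewrite inE; apply: enc_A.
Qed.

End Maximizer.

Section ReindexAuxiliary.
Variables (R : realType) (X Y X2 Z S : finType).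
Variables (px : X -> R) (W2 : X -> Y -> R) (pu : X -> Y -> S -> R).
Variables (W3 : X -> X2 -> Y -> Z -> R) (f : S -> X -> Y -> X2).

(** The theorem takes U in some ['I_k], so the strategies are numbered. *)
Lemma receiver_rate_enum_val :
  receiver_rate px W2 (fun x y (u : 'I_#|S|) => pu x y (enum_val u)) W3 (fun u => f (enum_val u)) =
  receiver_rate px W2 pu W3 f.
Proof.
have re (F : S -> R) : \sum_(u < #|S|) F (enum_val u) = \sum_s F s.
  by rewrite [RHS](reindex (@enum_val S predT)) //; exact/onW_bij/enum_val_bij.
rewrite /receiver_rate; congr (_ - _ + _).
- apply: eq_bigr => z _; congr nxlnx; apply: eq_bigr => x _.
  exact: (re (fun s => px x * auxZ W2 pu W3 f x s z)).
- apply: eq_bigr => x _; congr (_ * _).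
  exact: (re (fun s => \sum_z nxlnx (auxZ W2 pu W3 f x s z))).
- apply: eq_bigr => x _; congr (_ * _); apply: eq_bigr => y _; congr (_ * _).
  exact: (re (fun s => nxlnx (pu x y s))).
Qed.

End ReindexAuxiliary.

(** * Bounds on achievable rates *)

Section Capacity.
Variables (R : realType) (X1 X2 Y2 Y3 : finType).
Variables (W2 : X1 -> Y2 -> R) (W3 : X1 -> X2 -> Y2 -> Y3 -> R).
Hypothesis HW2 : forall x, is_pmf (W2 x).
Hypothesis HW3 : forall x x2 y, is_pmf (W3 x x2 y).

Lemma relay_value_eta (k : nat) (px : X1 -> R) (pu : X1 -> Y2 -> 'I_k -> R)
    (f : 'I_k -> X1 -> Y2 -> X2) : is_pmf px -> (forall x y, is_pmf (pu x y)) ->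
  relay_value W2 W3 px pu f = Num.min (relay_rate px W2) (receiver_rate px W2 pu W3 f) / ln 2.
Proof. by move=> Hpx Hpu; rewrite relay_valueE // info_XYE // info_XUZ_subE. Qed.

(** At rate zero there is a single message, which a constant decoder gets right. This makes the set
    of achievable rates nonempty and the capacity nonnegative. *)
Lemma achievable0 (x10 : X1) (x20 : X2) : achievable W2 W3 0.
Proof.
have M1 n : num_msgs n (0 : R) = 1%N by rewrite /num_msgs mulr0 ceil0.
have M0 n : (0 < num_msgs n (0 : R))%N by rewrite M1.
split=> //; exists (fun n => RelayCode (fun=> [ffun=> x10]) (fun=> [ffun=> x20])
  (fun=> Some (Ordinal (M0 n)))).
rewrite (_ : (fun n => _) = (fun=> 0)); first exact: cvg_cst.
apply/funext => n; rewrite /err_prob /= big1 ?mulr0 // => m _.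
rewrite big1 // => y2 _; rewrite big_pred0 // => y3; apply/negbTE; rewrite negbK.
apply/eqP; congr Some; apply: val_inj => /=.
by apply/esym/eqP; rewrite -leqn0 -ltnS -[X in (_ < X)%N](M1 n).
Qed.

Hypothesis Hdeg : forall x1 x1' x2 y2 y3, W3 x1 x2 y2 y3 = W3 x1' x2 y2 y3.

Lemma achievable_le (x20 : X2) (g r : R) :
  (forall px pu, is_pmf px -> (forall x y, is_pmf (pu x y)) ->
     Num.min (relay_rate px W2) (receiver_rate px W2 pu W3 (@strategy X1 Y2 X2)) <= g) ->
  achievable W2 W3 r -> r <= g / ln 2.
Proof.
move=> Hg [r0 [c cvg_c]].
have l2 : 0 < ln (2 : R) by rewrite ln_gt0 // ltr1n.
rewrite ler_pdivlMr // leNgt; apply/negP => lt.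
set rl := r * ln 2 in lt; have rl0 : 0 <= rl by rewrite mulr_ge0 // ltW.
pose gap := rl - g; have gap0 : 0 < gap by rewrite subr_gt0.
(* Half of the gap pays for the loss Pe * rl and half, once n is large, for the ln 2 of Fano's
   inequality. The bound 1 keeps 1 - Pe nonnegative, and [rl + 1] avoids a division by zero at rate
   0. *)
pose e := Num.min 1 (gap / 2 / (rl + 1)).
have rl1 : 0 < rl + 1 by rewrite ltr_wpDl.
have e0 : 0 < e by rewrite lt_min ltr01 !divr_gt0.
have [n [n0 Pe_lt n_gt]] : exists n, [/\ (0 < n)%N, err_prob W2 W3 (c n) < e &
    2 * ln 2 / gap < n%:R].
  near eventually => n; exists n; split.
  - by near: n; exists 1%N.
  - rewrite -[ltLHS]ger0_norm ?err_prob_ge0 // -normrN -[- _]sub0r.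
    by near: n; move/cvgrPdist_lt : cvg_c; apply.
  - by near: n; exact: nbhs_infty_gtr.
have nr : 0 < n%:R :> R by rewrite ltr0n.
move: Pe_lt; rewrite lt_min => /andP[Pe1 Pe2].
have M0 : (0 < num_msgs n r)%N by rewrite expn_gt0.
have [px [pu [Hpx Hpu leA leB]]] := converse HW2 HW3 Hdeg n0 M0 (c n) x20.
set Pe := err_prob W2 W3 (c n) in Pe1 Pe2 leA leB.
have le_g : (1 - Pe) * ln (num_msgs n r)%:R - ln 2 <= n%:R * g.
  apply: (@le_trans _ _ (n%:R * Num.min (relay_rate px W2) (receiver_rate px W2 pu W3 (@strategy X1 Y2 X2)))).
    by rewrite minr_pMr ?(ltW nr) // le_min leA.
  by rewrite ler_pM2l // Hg.
have le_M : n%:R * rl <= ln (num_msgs n r)%:R.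
  rewrite num_msgsE // expRK mulrA ler_pM2r //; exact: ceil_ge.
have le1 : (1 - Pe) * (n%:R * rl) <= (1 - Pe) * ln (num_msgs n r)%:R.
  by rewrite ler_wpM2l // subr_ge0 ltW.
have Pe_rl : Pe * rl < gap / 2.
  apply: (@le_lt_trans _ _ (Pe * (rl + 1))).
    by rewrite ler_wpM2l ?err_prob_ge0 // lerDl.
  by rewrite -ltr_pdivlMr.
have ln_n : ln 2 < n%:R * (gap / 2).
  by move: n_gt; rewrite ltr_pdivrMr //; lra.
have : n%:R * (Pe * rl) < n%:R * (gap / 2) by rewrite ltr_pM2l.
have : n%:R * gap = n%:R * rl - n%:R * g by rewrite -mulrBr.
have e1 : (1 - Pe) * (n%:R * rl) = n%:R * rl - n%:R * (Pe * rl) by ring.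
by move: le_g le1 ln_n; rewrite e1; lra.
Unshelve. all: by end_near.
Qed.

End Capacity.

Theorem theorem5 (R : realType) (X1 X2 Y2 Y3 : finType)
  (W2 : X1 -> Y2 -> R) (W3 : X1 -> X2 -> Y2 -> Y3 -> R)
  (hX1 : (0 < #|X1|)%N) (hX2 : (0 < #|X2|)%N)
  (hY2 : (0 < #|Y2|)%N) (hY3 : (0 < #|Y3|)%N)
  (HW2 : forall x1, is_pmf (W2 x1))
  (HW3 : forall x1 x2 y2, is_pmf (W3 x1 x2 y2))
  (Hdeg : forall x1 x1' x2 y2 y3, W3 x1 x2 y2 y3 = W3 x1' x2 y2 y3) :
  (exists (k : nat) (px : X1 -> R) (pu : X1 -> Y2 -> 'I_k -> R)
          (f : 'I_k -> X1 -> Y2 -> X2),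
      is_pmf px /\ (forall x1 y2, is_pmf (pu x1 y2)) /\
      relay_value W2 W3 px pu f = capacity W2 W3) /\
  (forall (k : nat) (px : X1 -> R) (pu : X1 -> Y2 -> 'I_k -> R)
          (f : 'I_k -> X1 -> Y2 -> X2),
      is_pmf px -> (forall x1 y2, is_pmf (pu x1 y2)) ->
      relay_value W2 W3 px pu f <= capacity W2 W3).
Proof.
have /card_gt0P[x10 _] := hX1; have /card_gt0P[x20 _] := hX2.
have [px [pu [Hpx Hpu pmax]]] := max_value W2 W3 x10 x20.
set g := Num.min _ _ in pmax.
have ub r : achievable W2 W3 r -> r <= g / ln 2.
  exact: (achievable_le HW2 HW3 Hdeg x20).
have ach0 := achievable0 W2 W3 x10 x20.
have lower k qx (qu : X1 -> Y2 -> 'I_k -> R) f :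
    is_pmf qx -> (forall x1 y2, is_pmf (qu x1 y2)) ->
    relay_value W2 W3 qx qu f <= capacity W2 W3.
  move=> Hqx Hqu; rewrite leNgt; apply/negP => lt.
  have sup_ub r : achievable W2 W3 r -> r <= capacity W2 W3.
    (* By the converse the set of rates is bounded, so [sup] is an upper bound of it. *)
    by move=> ach; apply: ub_le_sup => //; exists (g / ln 2).
  have cap0 := sup_ub _ ach0.
  (* The midpoint lies strictly below the value, hence is achievable, and strictly above the
     capacity, a contradiction. *)
  have ach : achievable W2 W3 ((capacity W2 W3 + relay_value W2 W3 qx qu f) / 2).
    by apply: (relay_value_achievable HW2 HW3 x10 x20 Hqx Hqu); lra.
  have := sup_ub _ ach; lra.
split=> //.
pose S : finType := {ffun Y2 -> X2}.
pose pu' x y (u : 'I_#|S|) := pu x y (enum_val u).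
have Hpu' x y : is_pmf (pu' x y).
  have [pu0 pu1] := Hpu x y; split=> [u|]; first exact: pu0.
  rewrite -pu1 [RHS](reindex (@enum_val S predT)) //.
  exact/onW_bij/enum_val_bij.
exists #|S|, px, pu', (fun u => @strategy X1 Y2 X2 (enum_val u)); split=> //; split=> //.
apply/eqP; rewrite eq_le lower //=.
rewrite relay_value_eta // (@receiver_rate_enum_val _ _ _ _ _ S) -/g.
by apply: ge_sup => [|r]; [exists 0|exact: ub].
Qed.
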